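(* Let $i,j\in I$ with $i$ odd, and let $\mathrm d_{i,\mu}\in\mathrm{End}_{\mathfrak U(\mathfrak g)}(1_\mu)$ denote the odd bubble of color $i$. Then for all $\lambda\in P$, in the Kac-Moody 2-supercategory $\mathfrak U(\mathfrak g)$ (with juxtaposition meaning horizontal composition), $$\mathrm d_{i,\lambda+\alpha_j}\,E_j1_\lambda=E_j1_\lambda\,\mathrm d_{i,\lambda},\qquad \mathrm d_{i,\lambda-\alpha_j}\,F_j1_\lambda=F_j1_\lambda\,\mathrm d_{i,\lambda}.$$
   Context: **Super conventions.** $\Bbbk=\Bbbk_{\bar0}\oplus\Bbbk_{\bar1}$ is a fixed supercommutative ground ring; $|x|\in\mathbb Z/2$ denotes parity. A superspace is a $\mathbb Z/2$-graded $(\Bbbk,\Bbbk)$-bimodule with $cv=(-1)^{|c||v|}vc$. A (strict) 2-supercategory consists of objects, 1-morphisms $F:\lambda\to\mu$ (composed strictly associatively and unitally, $GF$ meaning first $F$), and superspaces of 2-morphisms $F\Rightarrow F'$, with bilinear, parity-preserving, associative, unital vertical composition $\circ$ and horizontal composition (written by juxtaposition) satisfying the super interchange law $(vu)\circ(yx)=(-1)^{|u||y|}(v\circ y)(u\circ x)$. The same symbol denotes a 1-morphism and its identity 2-morphism; thus $(yH)\circ(Gx)=yx=(-1)^{|x||y|}(Kx)\circ(yF)$ for $x:F\to H$, $y:G\to K$. **Data.** $I$ is a set with parity function $i\mapsto|i|\in\mathbb Z/2$ ($2$ is invertible in $\Bbbk$ if $I$ has odd elements). $(-d_{ij})_{i,j\in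 I}$ is a generalized Cartan matrix: $d_{ii}=-2$, $d_{ij}\in\mathbb Z_{\ge0}$ for $i\ne j$, $d_{ij}=0\Leftrightarrow d_{ji}=0$; moreover $|i|=\bar1\Rightarrow d_{ij}$ is even. $\mathfrak h$ is a complex vector space with linearly independent $\{\alpha_i\}\subset\mathfrak h^*$, $\{h_i\}\subset\mathfrak h$, $\langle h_i,\alpha_j\rangle=-d_{ij}$; $P=\{\lambda\in\mathfrak h^*:\langle h_i,\lambda\rangle\in\mathbb Z\ \forall i\}$, $Q=\bigoplus_i\mathbb Z\alpha_i$; $\mathfrak g$ is the associated Kac-Moody algebra. Fix units $t_{ij}\in\Bbbk_{\bar0}^\times$ with $t_{ii}=1$ and $t_{ij}=t_{ji}$ if $d_{ij}=0$, and $s_{ij}^{pq}\in\Bbbk_{\bar0}$ ($0<p<d_{ij}$, $0<q<d_{ji}$) with $s_{ij}^{pq}=s_{ji}^{qp}$ and $s_{ij}^{pq}=0$ if $p|i|=\bar1$. **Kac-Moody 2-supercategory $\mathfrak U(\mathfrak g)$.** Objects: $P$. Generating 1-morphisms: $E_i1_\lambda:\lambda\to\lambda+\alpha_i$, $F_i1_\lambda:\lambda\to\lambda-\alpha_i$. Generating 2-morphisms, for all $\lambda$ (suppressed from notation): $x_i:E_i\to E_i$ of parity $|i|$, $\tau_{ij}:E_iE_j\to E_jE_i$ of parity $|i||j|$, $\eta_i:1_\lambda\to F_iE_i1_\lambda$ and $\varepsilon_i:E_iF_i1_\lambda\to1_\lambda$, both even. Powers $x_i^n$ are vertical powers. Relations: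 (R1) $\tau_{ji}\circ\tau_{ij}=0$ if $i=j$; $=t_{ij}E_iE_j$ if $d_{ij}=0$; otherwise $=t_{ij}x_i^{d_{ij}}E_j+t_{ji}E_ix_j^{d_{ji}}+\sum_{0<p<d_{ij},0<q<d_{ji}}s_{ij}^{pq}x_i^px_j^q$. (R2) $\tau_{ij}\circ(x_iE_j)-(-1)^{|i||j|}(E_jx_i)\circ\tau_{ij}=(x_jE_i)\circ\tau_{ij}-(-1)^{|i||j|}\tau_{ij}\circ(E_ix_j)=\delta_{i,j}E_iE_j$. (R3) $(\tau_{jk}E_i)\circ(E_j\tau_{ik})\circ(\tau_{ij}E_k)-(E_k\tau_{ij})\circ(\tau_{ik}E_j)\circ(E_i\tau_{jk})$ equals $\sum_{r+s=d_{ij}-1}(-1)^{|i|(|j|+s)}t_{ij}\,x_i^rE_jx_i^s+\sum_{0<p<d_{ij},0<q<d_{ji},\,r+s=p-1}(-1)^{|i|(|j|+s)}s_{ij}^{pq}\,x_i^rx_j^qx_i^s$ ($r,s\ge0$) if $i=k\ne j$, and $0$ otherwise. (R4) $(\varepsilon_iE_i)\circ(E_i\eta_i)=E_i$, $(F_i\varepsilon_i)\circ(\eta_iF_i)=F_i$. (R5) Put $\sigma_{ji}:=(F_iE_j\varepsilon_i)\circ(F_i\tau_{ij}F_i)\circ(\eta_iE_jF_i):E_jF_i1_\lambda\to F_iE_j1_\lambda$. Then the following are required to be isomorphisms (in the additive envelope), i.e. the matrix entries of two-sided inverses are adjoined as further generating 2-morphisms: $\sigma_{ji}$ for $i\ne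 j$; with $h=\langle h_i,\lambda\rangle$, the column $M$ with entries $\sigma_{ii}$ and $\varepsilon_i\circ(x_i^nF_i)$ ($0\le n<h$): $E_iF_i1_\lambda\to F_iE_i1_\lambda\oplus1_\lambda^{\oplus h}$ if $h\ge0$; the row $M$ with entries $\sigma_{ii}$ and $(F_ix_i^n)\circ\eta_i$ ($0\le n<-h$): $E_iF_i1_\lambda\oplus1_\lambda^{\oplus -h}\to F_iE_i1_\lambda$ if $h\le0$. **Leftward morphisms.** Fix units $c_{\lambda;i}\in\Bbbk_{\bar0}^\times$ with $c_{\lambda+\alpha_j;i}=t_{ij}c_{\lambda;i}$. $|i,\lambda|:=|i|(\langle h_i,\lambda\rangle+1)$. Leftward crossing $\tau'_{ij}:F_iE_j1_\lambda\to E_jF_i1_\lambda$: $\tau'_{ij}:=\sigma_{ji}^{-1}$ if $i\neq j$, while $-\tau'_{ii}$ is the component $F_iE_i1_\lambda\to E_iF_i1_\lambda$ of $M^{-1}$. If $h=\langle h_i,\lambda\rangle>0$, let $\delta_n:1_\lambda\to E_iF_i1_\lambda$ ($0\le n<h$) be the other components of $M^{-1}$; if $h<0$, let $\gamma_n:F_iE_i1_\lambda\to1_\lambda$ ($0\le n<-h$) be the other components of $M^{-1}$. Then, of parity $|i,\lambda|$: $\eta'_i:1_\lambda\to E_iF_i1_\lambda$ is $c_{\lambda;i}\delta_{h-1}$ if $h>0$ and $(-1)^{|i,\lambda|}c_{\lambda;i}\,\tau'_{ii}\circ(F_ix_i^{-h})\circ\eta_i$ if $h\le0$; $\varepsilon'_i:F_iE_i1_\lambda\to1_\lambda$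 is $c_{\lambda;i}^{-1}\gamma_{-h-1}$ if $h<0$ and $-(-1)^{|i|h}c_{\lambda;i}^{-1}\,\varepsilon_i\circ(x_i^hF_i)\circ\tau'_{ii}$ if $h\ge0$. **Odd bubble.** For $m\ge0$ put $\mathrm{cw}_{i,\lambda}(m):=\varepsilon_i\circ(x_i^mF_i)\circ\eta'_i$ and $\mathrm{ccw}_{i,\lambda}(m):=\varepsilon'_i\circ(F_ix_i^m)\circ\eta_i$ in $\mathrm{End}(1_\lambda)$. For $i$ odd and $h=\langle h_i,\lambda\rangle$, the odd bubble of color $i$ is $\mathrm d_{i,\lambda}:=c_{\lambda;i}^{-1}\mathrm{cw}_{i,\lambda}(h)$ if $h\ge0$ and $\mathrm d_{i,\lambda}:=c_{\lambda;i}\mathrm{ccw}_{i,\lambda}(-h)$ if $h\le0$ (the two definitions agree when $h=0$). *)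

(* Defs.v *)
From HB Require Import structures.
From mathcomp Require Import all_boot all_order all_algebra.
From mathcomp Require Import complex.
From mathcomp Require Import boolp functions reals.

Set Implicit Arguments.
Unset Strict Implicit.
Unset Printing Implicit Defensive.

Import Order.TTheory GRing.Theory Num.Theory.

Local Open Scope ring_scope.
Local Open Scope complex_scope.

(* A supercommutative structure on k; parities are booleans, [true] is odd.   *)
Record supercommutative (k : unitRingType) := Supercommutative {
  gr :> bool -> k -> Prop;
  gr0 : forall p, gr p 0;
  grB : forall p x y, gr p x -> gr p y -> gr p (x - y);
  gr1 : gr false 1;
  grM : forall p q x y, gr p x -> gr q y -> gr (p (+) q) (x * y);
  gr_gen : forall x, exists x0 x1, [/\ gr false x0, gr true x1 & x = x0 + x1];
  gr_direct : forall x, gr false x -> gr true x -> x = 0;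
  gr_comm : forall p q x y, gr p x -> gr q y -> x * y = (-1) ^+ (p && q) * (y * x)
}.

(* The generalized Cartan matrix is (- d i j).                                *)
Record super_cartan (I : eqType) := SuperCartan {
  par : I -> bool;
  dij : I -> I -> int;
  dij_diag : forall i, dij i i = - 2%:Z;
  dij_ge0 : forall i j, i != j -> 0 <= dij i j;
  dij_eq0 : forall i j, dij i j = 0 <-> dij j i = 0;
  dij_even : forall i j, par i -> ~~ odd `|dij i j|
}.

Definition lin_indep (C : nzRingType) (V : lmodType C) (I : eqType)
    (v : I -> V) : Prop :=
  forall (r : seq I) (a : I -> C), uniq r ->
    \sum_(i <- r) a i *: v i = 0 -> forall i, i \in r -> a i = 0.

Record realization (R : realType) (I : eqType) (D : super_cartan I) :=
  Realization {
  cartan : lmodType R[i];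
  sroot : I -> {linear cartan -> R[i]^o};
  coroot : I -> cartan;
  sroot_indep : lin_indep (fun i => sroot i : cartan -> R[i]^o);
  coroot_indep : lin_indep coroot;
  coroot_sroot : forall i j, sroot j (coroot i) = - (dij D i j)%:~R
}.

Section Weights.
Variables (R : realType) (I : eqType) (D : super_cartan I).
Variable (H : realization R D).

Definition integral_weight : {pred (cartan H -> R[i]^o)} :=
  fun f => `[< linear f /\ forall i, exists z : int, f (coroot H i) = z%:~R >].

Fact integral_weight_zmod : zmod_closed integral_weight.
Proof.
split.
  apply/asboolP; split; first by move=> a x y /=; rewrite scaler0 addr0.
  by move=> i; exists 0.
move=> f g /asboolP[linf Zf] /asboolP[ling Zg]; apply/asboolP; split.
  move=> a x y; rewrite !fctE linf ling scalerBr.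
  by rewrite opprD addrACA.
move=> i; have [[z zE] [w wE]] := (Zf i, Zg i).
by exists (z - w); rewrite !fctE zE wE rmorphB.
Qed.

HB.instance Definition _ :=
  GRing.isZmodClosed.Build (cartan H -> R[i]^o) integral_weight
    integral_weight_zmod.

Record weight := Weight {
  weight_val :> cartan H -> R[i]^o;
  weightP : weight_val \in integral_weight
}.

HB.instance Definition _ := [isSub for weight_val].
HB.instance Definition _ := [Choice of weight by <:].
HB.instance Definition _ := [SubChoice_isSubZmodule of weight by <:].

Fact sroot_integral i : (sroot H i : cartan H -> R[i]^o) \in integral_weight.
Proof.
apply/asboolP; split; first exact: linearP.
by move=> j; exists (- dij D j i); rewrite coroot_sroot rmorphN.
Qed.

Definition alpha (i : I) : weight := Weight (sroot_integral i).

Fact hwt_subproof (l : weight) i : exists z : int, l (coroot H i) = z%:~R.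
Proof. by have /asboolP[_] := weightP l. Qed.

(* <h_i, l> as an integer *)
Definition hwt (i : I) (l : weight) : int := projT1 (cid (hwt_subproof l i)).

End Weights.

Arguments alpha {R I D} H i.

Record parameters (k : unitRingType) (gr : supercommutative k) (I : eqType)
    (D : super_cartan I) := MkParameters {
  tij : I -> I -> k;
  sij : I -> I -> nat -> nat -> k;
  two_unit : (exists i, par D i) -> (2%:R : k) \is a GRing.unit;
  tij_even : forall i j, gr false (tij i j);
  tij_unit : forall i j, tij i j \is a GRing.unit;
  tij_diag : forall i, tij i i = 1;
  tij_sym : forall i j, dij D i j = 0 -> tij i j = tij j i;
  (* only the values with 0 < p < d_ij and 0 < q < d_ji are meaningful *)
  sij_even : forall i j (p q : nat), (0 < p)%N -> p%:Z < dij D i j ->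
    (0 < q)%N -> q%:Z < dij D j i -> gr false (sij i j p q);
  sij_sym : forall i j (p q : nat), (0 < p)%N -> p%:Z < dij D i j ->
    (0 < q)%N -> q%:Z < dij D j i -> sij i j p q = sij j i q p;
  sij_odd : forall i j (p q : nat), (0 < p)%N -> p%:Z < dij D i j ->
    (0 < q)%N -> q%:Z < dij D j i -> odd p && par D i -> sij i j p q = 0
}.

Record normalization (R : realType) (I : eqType) (D : super_cartan I)
    (H : realization R D) (k : unitRingType) (gr : supercommutative k)
    (Q : parameters gr D) := Normalization {
  cnorm : weight H -> I -> k;
  cnorm_even : forall l i, gr false (cnorm l i);
  cnorm_unit : forall l i, cnorm l i \is a GRing.unit;
  cnorm_add : forall l i j, cnorm (l + alpha H j) i = tij Q i j * cnorm l i
}.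

Inductive letter (I : Type) := E of I | F of I.

Declare Scope two_mor_scope.
Delimit Scope two_mor_scope with M2.

Section KacMoody.
Variables (R : realType) (I : eqType) (D : super_cartan I).
Variables (H : realization R D).
Variables (k : unitRingType) (gr : supercommutative k) (Q : parameters gr D).

Local Notation P := (weight H).
Local Notation wd := (seq (letter I)).

(* A 1-morphism l -> m is a word w with m = tgt l w; the rightmost letter acts
   first, so that the composition of 1-morphisms is concatenation.            *)
Fixpoint tgt (l : P) (w : wd) : P :=
  match w with
  | [::] => l
  | E i :: w' => tgt l w' + alpha H i
  | F i :: w' => tgt l w' - alpha H i
  end.

Definition hpos (i : I) (l : P) : nat := if hwt i l is Posz n then n else 0%N.
Definition hneg (i : I) (l : P) : nat := if - hwt i l is Posz n then n else 0%N.

(* Formal 2-morphisms between words with source object l. [sinv i j] is the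
   inverse of sigma_{ji} for i <> j and the F_i E_i -> E_i F_i entry of M^-1 for
   i = j; [del] and [gam] are the remaining entries of M^-1. In
   [hcomp y x e] the factor y lives over the target m of the source of x.     *)
Inductive mor2 : P -> wd -> wd -> Type :=
| id2 l a : mor2 l a a
| zero2 l a b : mor2 l a b
| add2 l a b : mor2 l a b -> mor2 l a b -> mor2 l a b
| scale2 l a b : k -> mor2 l a b -> mor2 l a b
| vcomp l a b c : mor2 l b c -> mor2 l a b -> mor2 l a c
| hcomp l m a b a' b' : mor2 m a' b' -> mor2 l a b -> m = tgt l a ->
    mor2 l (a' ++ a) (b' ++ b)
| dot i l : mor2 l [:: E i] [:: E i]
| tau i j l : mor2 l [:: E i; E j] [:: E j; E i]
| eta i l : mor2 l [::] [:: F i; E i]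
| eps i l : mor2 l [:: E i; F i] [::]
| sinv i j l : mor2 l [:: F i; E j] [:: E j; F i]
| del i l (n : 'I_(hpos i l)) : mor2 l [::] [:: E i; F i]
| gam i l (n : 'I_(hneg i l)) : mor2 l [:: F i; E i] [::].

Arguments id2 {l} a.
Arguments zero2 {l a b}.
Arguments hcomp {l m a b a' b'} y x e.
Arguments dot i {l}.
Arguments tau i j {l}.
Arguments eta i {l}.
Arguments eps i {l}.
Arguments sinv i j {l}.
Arguments del {i l} n.
Arguments gam {i l} n.

Local Notation "y \ov x" := (vcomp y x) (at level 48, left associativity).
Local Notation "y \oh x" := (hcomp y x erefl) (at level 38, right associativity).
Local Notation "x +2 y" := (add2 x y) (at level 50, left associativity).
Local Notation "c *2 x" := (scale2 c x) (at level 40).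
Local Notation idE i := (id2 [:: E i]).
Local Notation idF i := (id2 [:: F i]).

Inductive homog : forall l a b, bool -> mor2 l a b -> Prop :=
| homog_id l a : homog false (@id2 l a)
| homog_zero p l a b : homog p (@zero2 l a b)
| homog_add p l a b (x y : mor2 l a b) :
    homog p x -> homog p y -> homog p (x +2 y)
| homog_scale p q l a b c (x : mor2 l a b) :
    gr p c -> homog q x -> homog (p (+) q) (c *2 x)
| homog_vcomp p q l a b c (y : mor2 l b c) (x : mor2 l a b) :
    homog p y -> homog q x -> homog (p (+) q) (y \ov x)
| homog_hcomp p q l m a b a' b' (e : m = tgt l a)
    (y : mor2 m a' b') (x : mor2 l a b) :
    homog p y -> homog q x -> homog (p (+) q) (hcomp y x e)
| homog_dot i l : homog (par D i) (@dot i l)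
| homog_tau i j l : homog (par D i && par D j) (@tau i j l)
| homog_eta i l : homog false (@eta i l)
| homog_eps i l : homog false (@eps i l)
| homog_sinv i j l : homog (par D i && par D j) (@sinv i j l)
| homog_del i l (n : 'I_(hpos i l)) : homog (odd n && par D i) (del n)
| homog_gam i l (n : 'I_(hneg i l)) : homog (odd n && par D i) (gam n).

Definition cast2 l a b a' b' (ea : a = a') (eb : b = b') (x : mor2 l a b) :
    mor2 l a' b' :=
  ecast z (mor2 l z b') ea (ecast z (mor2 l a z) eb x).

Definition sgn (b : bool) : k := (-1) ^+ b.

Definition sum2 (T : Type) l a b (r : seq T) (f : T -> mor2 l a b) :
    mor2 l a b :=
  foldr (fun t acc => f t +2 acc) zero2 r.

Definition xpow i n {l} : mor2 l [:: E i] [:: E i] :=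
  iter n (vcomp (dot i)) (idE i).

Definition sigma j i {l} : mor2 l [:: E j; F i] [:: F i; E j] :=
  (idF i \oh idE j \oh eps i) \ov (idF i \oh tau i j \oh idF i)
    \ov (eta i \oh idE j \oh idF i).

Definition epsx i n {l} : mor2 l [:: E i; F i] [::] :=
  eps i \ov (xpow i n \oh idF i).

Definition etax i n {l} : mor2 l [::] [:: F i; E i] :=
  (idF i \oh xpow i n) \ov eta i.

(* d_ij as a natural number, for i != j *)
Definition dn i j : nat := `|dij D i j|%N.

Definition quad_rhs i j {l} : mor2 l [:: E i; E j] [:: E i; E j] :=
  (tij Q i j *2 (xpow i (dn i j) \oh idE j))
  +2 (tij Q j i *2 (idE i \oh xpow j (dn j i)))
  +2 sum2 (iota 1 (dn i j).-1) (fun p =>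
       sum2 (iota 1 (dn j i).-1) (fun q =>
         sij Q i j p q *2 (xpow i p \oh xpow j q))).

Definition braid_lhs i j m {l} : mor2 l [:: E i; E j; E m] [:: E m; E j; E i] :=
  ((tau j m \oh idE i) \ov (idE j \oh tau i m) \ov (tau i j \oh idE m))
  +2 (-1) *2 ((idE m \oh tau i j) \ov (tau i m \oh idE j) \ov (idE i \oh tau j m)).

Definition braid_rhs i j {l} : mor2 l [:: E i; E j; E i] [:: E i; E j; E i] :=
  sum2 (iota 0 (dn i j)) (fun r => let s := ((dn i j).-1 - r)%N in
    (sgn (par D i && (par D j (+) odd s)) * tij Q i j)
      *2 (xpow i r \oh idE j \oh xpow i s))
  +2 sum2 (iota 1 (dn i j).-1) (fun p =>
       sum2 (iota 1 (dn j i).-1) (fun q =>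
         sum2 (iota 0 p) (fun r => let s := (p.-1 - r)%N in
           (sgn (par D i && (par D j (+) odd s)) * sij Q i j p q)
             *2 (xpow i r \oh xpow j q \oh xpow i s)))).

(* Equality of 2-morphisms of U(g): the congruence on formal 2-morphisms
   generated by the laws of a strict 2-supercategory over k, the defining
   relations, and the equations M^-1 M = 1 and M M^-1 = 1. One of hpos, hneg
   vanishes, so the matrix equations below cover both signs of <h_i, l>.      *)
Inductive eq2 : forall l a b, mor2 l a b -> mor2 l a b -> Prop :=
| eq2_refl l a b (x : mor2 l a b) : eq2 x x
| eq2_sym l a b (x y : mor2 l a b) : eq2 x y -> eq2 y x
| eq2_trans l a b (x y z : mor2 l a b) : eq2 x y -> eq2 y z -> eq2 x z
| eq2_add l a b (x x' y y' : mor2 l a b) :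
    eq2 x x' -> eq2 y y' -> eq2 (x +2 y) (x' +2 y')
| eq2_scale l a b c (x x' : mor2 l a b) : eq2 x x' -> eq2 (c *2 x) (c *2 x')
| eq2_vcomp l a b c (y y' : mor2 l b c) (x x' : mor2 l a b) :
    eq2 y y' -> eq2 x x' -> eq2 (y \ov x) (y' \ov x')
| eq2_hcomp l m a b a' b' (e : m = tgt l a) (y y' : mor2 m a' b')
    (x x' : mor2 l a b) :
    eq2 y y' -> eq2 x x' -> eq2 (hcomp y x e) (hcomp y' x' e)
(* k-linearity is stated for the left action; the right one is
   v c = (-1)^(|c||v|) c v, whence the signs in eq2_vZr and eq2_hZr *)
| eq2_addA l a b (x y z : mor2 l a b) : eq2 (x +2 (y +2 z)) (x +2 y +2 z)
| eq2_addC l a b (x y : mor2 l a b) : eq2 (x +2 y) (y +2 x)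
| eq2_add0 l a b (x : mor2 l a b) : eq2 (zero2 +2 x) x
| eq2_addN l a b (x : mor2 l a b) : eq2 ((-1) *2 x +2 x) zero2
| eq2_scaleA l a b c d (x : mor2 l a b) : eq2 (c *2 (d *2 x)) ((c * d) *2 x)
| eq2_scale1 l a b (x : mor2 l a b) : eq2 (1 *2 x) x
| eq2_scaleDr l a b c (x y : mor2 l a b) : eq2 (c *2 (x +2 y)) (c *2 x +2 c *2 y)
| eq2_scaleDl l a b c d (x : mor2 l a b) : eq2 ((c + d) *2 x) (c *2 x +2 d *2 x)
| eq2_vA l a b c d (z : mor2 l c d) (y : mor2 l b c) (x : mor2 l a b) :
    eq2 (z \ov (y \ov x)) (z \ov y \ov x)
| eq2_v1l l a b (x : mor2 l a b) : eq2 (id2 b \ov x) x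
| eq2_v1r l a b (x : mor2 l a b) : eq2 (x \ov id2 a) x
| eq2_vDl l a b c (y y' : mor2 l b c) (x : mor2 l a b) :
    eq2 ((y +2 y') \ov x) (y \ov x +2 y' \ov x)
| eq2_vDr l a b c (y : mor2 l b c) (x x' : mor2 l a b) :
    eq2 (y \ov (x +2 x')) (y \ov x +2 y \ov x')
| eq2_vZl l a b c d (y : mor2 l b c) (x : mor2 l a b) :
    eq2 ((d *2 y) \ov x) (d *2 (y \ov x))
| eq2_vZr l a b c d p q (y : mor2 l b c) (x : mor2 l a b) :
    gr p d -> homog q y ->
    eq2 (y \ov (d *2 x)) ((sgn (p && q) * d) *2 (y \ov x))
| eq2_h1 l m a b (e : m = tgt l a) :
    eq2 (hcomp (id2 b) (id2 a) e) (id2 (b ++ a))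
| eq2_hA l m n a a' b b' c c' (em : m = tgt l a) (en : n = tgt m b)
    (en' : n = tgt l (b ++ a))
    (z : mor2 n c c') (y : mor2 m b b') (x : mor2 l a a') :
    eq2 (cast2 (catA c b a) (catA c' b' a') (hcomp z (hcomp y x em) en'))
        (hcomp (hcomp z y en) x em)
| eq2_h1l l a b m (e : m = tgt l a) (x : mor2 l a b) :
    eq2 (hcomp (id2 [::]) x e) x
| eq2_h1r l a b (x : mor2 l a b) :
    eq2 (cast2 (cats0 a) (cats0 b) (hcomp x (id2 [::]) (erefl : l = tgt l [::]))) x
| eq2_hDl l m a b a' b' (e : m = tgt l a) (y y' : mor2 m a' b')
    (x : mor2 l a b) :
    eq2 (hcomp (y +2 y') x e) (hcomp y x e +2 hcomp y' x e)
| eq2_hDr l m a b a' b' (e : m = tgt l a) (y : mor2 m a' b')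
    (x x' : mor2 l a b) :
    eq2 (hcomp y (x +2 x') e) (hcomp y x e +2 hcomp y x' e)
| eq2_hZl l m a b a' b' (e : m = tgt l a) d (y : mor2 m a' b')
    (x : mor2 l a b) :
    eq2 (hcomp (d *2 y) x e) (d *2 hcomp y x e)
| eq2_hZr l m a b a' b' (e : m = tgt l a) d p q (y : mor2 m a' b')
    (x : mor2 l a b) :
    gr p d -> homog q y ->
    eq2 (hcomp y (d *2 x) e) ((sgn (p && q) * d) *2 hcomp y x e)
| eq2_interchange l m a b c a' b' c' (e : m = tgt l a) (e' : m = tgt l b) p q
    (v : mor2 m b' c') (u : mor2 l b c) (y : mor2 m a' b') (x : mor2 l a b) :
    homog p u -> homog q y ->
    eq2 (hcomp v u e' \ov hcomp y x e)
        (sgn (p && q) *2 hcomp (v \ov y) (u \ov x) e)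
| eq2_quad_diag i l : eq2 (tau i i \ov tau i i : mor2 l _ _) zero2
| eq2_quad_0 i j l : dij D i j = 0 ->
    eq2 (tau j i \ov tau i j : mor2 l _ _) (tij Q i j *2 id2 [:: E i; E j])
| eq2_quad i j l : i != j -> dij D i j != 0 ->
    eq2 (tau j i \ov tau i j : mor2 l _ _) (quad_rhs i j)
| eq2_dotl i j l : i != j ->
    eq2 (tau i j \ov (dot i \oh idE j)
         +2 (- sgn (par D i && par D j)) *2 ((idE j \oh dot i) \ov tau i j)
         : mor2 l _ _) zero2
| eq2_dotl_diag i l :
    eq2 (tau i i \ov (dot i \oh idE i)
         +2 (- sgn (par D i && par D i)) *2 ((idE i \oh dot i) \ov tau i i)
         : mor2 l _ _) (id2 [:: E i; E i])
| eq2_dotr i j l : i != j ->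
    eq2 ((dot j \oh idE i) \ov tau i j
         +2 (- sgn (par D i && par D j)) *2 (tau i j \ov (idE i \oh dot j))
         : mor2 l _ _) zero2
| eq2_dotr_diag i l :
    eq2 ((dot i \oh idE i) \ov tau i i
         +2 (- sgn (par D i && par D i)) *2 (tau i i \ov (idE i \oh dot i))
         : mor2 l _ _) (id2 [:: E i; E i])
| eq2_braid i j m l : ~~ ((i == m) && (i != j)) ->
    eq2 (braid_lhs i j m : mor2 l _ _) zero2
| eq2_braid_iji i j l : i != j ->
    eq2 (braid_lhs i j i : mor2 l _ _) (braid_rhs i j)
| eq2_zigzagE i l :
    eq2 ((eps i \oh idE i) \ov (idE i \oh eta i) : mor2 l _ _) (idE i)
| eq2_zigzagF i l :
    eq2 ((idF i \oh eps i) \ov (eta i \oh idF i) : mor2 l _ _) (idF i)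
| eq2_sigmaK i j l : i != j ->
    eq2 (sinv i j \ov sigma j i : mor2 l _ _) (id2 [:: E j; F i])
| eq2_sinvK i j l : i != j ->
    eq2 (sigma j i \ov sinv i j : mor2 l _ _) (id2 [:: F i; E j])
| eq2_M_EF i l :
    eq2 (sinv i i \ov sigma i i
         +2 sum2 (enum 'I_(hpos i l)) (fun n => del n \ov epsx i n))
        (id2 [:: E i; F i])
| eq2_M_FE i l :
    eq2 (sigma i i \ov sinv i i
         +2 sum2 (enum 'I_(hneg i l)) (fun n => etax i n \ov gam n))
        (id2 [:: F i; E i])
| eq2_M_sigma_del i l (n : 'I_(hpos i l)) : eq2 (sigma i i \ov del n) zero2
| eq2_M_eps_sinv i l (n : 'I_(hpos i l)) :
    eq2 (epsx i n \ov sinv i i : mor2 l _ _) zero2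
| eq2_M_eps_del i l (n m : 'I_(hpos i l)) :
    eq2 (epsx i n \ov del m) (if n == m then id2 [::] else zero2)
| eq2_M_gam_sigma i l (n : 'I_(hneg i l)) : eq2 (gam n \ov sigma i i) zero2
| eq2_M_sinv_eta i l (n : 'I_(hneg i l)) :
    eq2 (sinv i i \ov etax i n : mor2 l _ _) zero2
| eq2_M_gam_eta i l (n m : 'I_(hneg i l)) :
    eq2 (gam n \ov etax i m) (if n == m then id2 [::] else zero2).

Variable (c : normalization H Q).

Definition ltau i j {l} : mor2 l [:: F i; E j] [:: E j; F i] :=
  if i == j then (-1) *2 sinv i j else sinv i j.

Definition leta i {l} : mor2 l [::] [:: E i; F i] :=
  if (insub (hpos i l).-1 : option 'I_(hpos i l)) is Some n then
    (* <h_i, l> > 0 and n = <h_i, l> - 1 *)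
    cnorm c l i *2 del n
  else
    (sgn (par D i && ~~ odd `|hwt i l|) * cnorm c l i)
      *2 (ltau i i \ov etax i `|hwt i l|).

Definition leps i {l} : mor2 l [:: F i; E i] [::] :=
  if (insub (hneg i l).-1 : option 'I_(hneg i l)) is Some n then
    (* <h_i, l> < 0 and n = - <h_i, l> - 1 *)
    (cnorm c l i)^-1 *2 gam n
  else
    (- sgn (par D i && odd `|hwt i l|) * (cnorm c l i)^-1)
      *2 (epsx i `|hwt i l| \ov ltau i i).

Definition cw i (n : nat) {l} : mor2 l [::] [::] :=
  eps i \ov (xpow i n \oh idF i) \ov leta i.

Definition ccw i (n : nat) {l} : mor2 l [::] [::] :=
  leps i \ov (idF i \oh xpow i n) \ov eta i.

(* for <h_i, l> = 0 the two formulas agree in U(g) *)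
Definition odd_bubble i l : mor2 l [::] [::] :=
  if 0 <= hwt i l then (cnorm c l i)^-1 *2 cw i `|hwt i l|
  else cnorm c l i *2 ccw i `|hwt i l|.

End KacMoody.

Arguments id2 {R I D H k l} a.
Arguments zero2 {R I D H k l a b}.
Arguments hcomp {R I D H k l m a b a' b'} y x e.
Arguments eq2 {R I D H k gr} Q {l a b} x y.
Arguments odd_bubble {R I D H k gr Q} c i l.

Notation "y \oh x" := (hcomp y x erefl)
  (at level 38, right associativity) : two_mor_scope.
Notation "x '=[' Q ']=' y" := (eq2 Q x y)
  (at level 70, no associativity, format "x  =[ Q ]=  y") : two_mor_scope.

(* Main.v *)
(* For a fixed source weight, words in the letters E_i, F_i are the objects of a
   category on which every letter acts as an endofunctor, and the generating
   2-morphisms are (super)natural transformations of these endofunctors.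

   Let h = <h_i, l>.  Up to the units c_{l;i}, the odd bubble is
   eps x^h del_{h-1} if h > 0, eps sigma^-1 eta if h = 0 and
   gam_{|h|-1} x^|h| eta if h < 0, where del_n, gam_n are the entries of M^-1.
   If both weights l and l + alpha_j have h >= 0, pull the strand j to the right
   through del_{h-1} using tau_ji and sigma_ji.  The result Phi is determined by
   its composites with the entries of M at l + alpha_j, which are computed by
     the
   braid relation rotated by sigma and by the quadratic relation (for j = i, by
   the nilHecke relations): Phi is a unit times the corresponding entry of M^-1
     at
   l + alpha_j, and capping it off with one more dot gives the slide, the
   correction terms vanishing because d_ij is even and s_ij^{pq} = 0 for p odd
   (for j = i, two dots cancel by sign).  The case of two weights with h <= 0 is
   dual.  If h changes sign and j <> i, the two bubbles are the only surviving
   terms of the rotated braid relation;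
     if j = i then h goes from -1 to 1 and the
   inverses can be compared directly.
     The slide past F_j follows by adjunction. *)
From HB Require Import structures.
Require Import Defs.
From mathcomp Require Import all_boot all_order all_algebra.
From mathcomp Require Import complex boolp functions reals zify.

Set Implicit Arguments.
Unset Strict Implicit.
Unset Printing Implicit Defensive.

Import Order.TTheory GRing.Theory Num.Theory.

Local Open Scope ring_scope.
Local Open Scope two_mor_scope.

(** * The quotient 2-category *)

Section Quotient.
Variables (R : realType) (I : eqType) (D : super_cartan I).
Variables (H : realization R D).
Variables (k : unitRingType) (gr : supercommutative k) (Q : parameters gr D).

Local Notation P := (weight H).
Local Notation wd := (seq (letter I)).

(** A class is the predicate [eq2 Q x]. By extensionality [eq2] becomes Leibniz equality, so that
    rewriting replaces congruence steps. *)
Record mhom (l : P) (a b : wd) := MHom {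
  hom_class : mor2 k l a b -> Prop;
  hom_classP : exists x, hom_class = eq2 Q x
}.

HB.instance Definition _ l a b := gen_eqMixin (mhom l a b).
HB.instance Definition _ l a b := gen_choiceMixin (mhom l a b).

Lemma hom_inj l a b (X Y : mhom l a b) : hom_class X = hom_class Y -> X = Y.
Proof.
by case: X Y => [C CP] [C' CP'] /= e; subst C'; congr MHom;
  apply: Prop_irrelevance.
Qed.

Definition cls l a b (x : mor2 k l a b) : mhom l a b :=
  MHom (ex_intro _ x erefl).

Lemma cls_eq l a b (x y : mor2 k l a b) : cls x = cls y <-> eq2 Q x y.
Proof.
split=> [[exy]|exy].
  have : eq2 Q y y by exact: eq2_refl.
  by rewrite -exy.
apply: hom_inj; apply/funext => z; apply/propext; split; last exact: eq2_trans.
by apply: eq2_trans; apply: eq2_sym.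
Qed.

Definition crep l a b (X : mhom l a b) : mor2 k l a b :=
  projT1 (cid (hom_classP X)).

Lemma cls_crep l a b (X : mhom l a b) : cls (crep X) = X.
Proof.
by apply: hom_inj; rewrite /crep; case: cid.
Qed.

Lemma crep_cls l a b (x : mor2 k l a b) : eq2 Q (crep (cls x)) x.
Proof. by apply/cls_eq; rewrite cls_crep. Qed.

Lemma homP l a b (X : mhom l a b) : exists x, X = cls x.
Proof. by exists (crep X); rewrite cls_crep. Qed.

Section HomModule.
Variables (l : P) (a b : wd).
Implicit Types X Y Z : mhom l a b.

Definition addh X Y := cls (add2 (crep X) (crep Y)).
Definition scaleh (c : k) X := cls (scale2 c (crep X)).
Definition zeroh : mhom l a b := cls zero2.
Definition opph X := scaleh (-1) X.

Lemma addhE x y : addh (cls x) (cls y) = cls (add2 x y).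
Proof. by apply/cls_eq/eq2_add; apply: crep_cls. Qed.
Lemma scalehE c x : scaleh c (cls x) = cls (scale2 c x).
Proof. by apply/cls_eq/eq2_scale; apply: crep_cls. Qed.

Fact addhA : associative addh.
Proof.
move=> X Y Z; case: (homP X) (homP Y) (homP Z) => [x ->] [y ->] [z ->].
by rewrite !addhE; apply/cls_eq/eq2_addA.
Qed.
Fact addhC : commutative addh.
Proof.
move=> X Y; case: (homP X) (homP Y) => [x ->] [y ->].
by rewrite !addhE; apply/cls_eq/eq2_addC.
Qed.
Fact add0h : left_id zeroh addh.
Proof.
by move=> X; case: (homP X) => [x ->]; rewrite addhE; apply/cls_eq/eq2_add0.
Qed.
Fact addNh : left_inverse zeroh opph addh.
Proof.
move=> X; case: (homP X) => [x ->]; rewrite /opph scalehE addhE.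
exact/cls_eq/eq2_addN.
Qed.

HB.instance Definition _ :=
  GRing.isZmodule.Build (mhom l a b) addhA addhC add0h addNh.

Fact scalehA c d X : scaleh c (scaleh d X) = scaleh (c * d) X.
Proof. by case: (homP X) => x ->; rewrite !scalehE;
  apply/cls_eq/eq2_scaleA. Qed.
Fact scale1h : left_id 1 scaleh.
Proof. by move=> X; case: (homP X) => x ->; rewrite !scalehE;
  apply/cls_eq/eq2_scale1. Qed.
Fact scalehDr : right_distributive scaleh +%R.
Proof.
move=> c X Y; case: (homP X) (homP Y) => [x ->] [y ->].
rewrite [cls x + _]addhE !scalehE [RHS]addhE; exact/cls_eq/eq2_scaleDr.
Qed.
Fact scalehDl X : {morph scaleh^~ X : c d / c + d}.
Proof.
move=> c d; case: (homP X) => [x ->].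
rewrite !scalehE [RHS]addhE; exact/cls_eq/eq2_scaleDl.
Qed.

HB.instance Definition _ :=
  GRing.Zmodule_isLmodule.Build k (mhom l a b)
    scalehA scale1h scalehDr scalehDl.

Lemma clsD x y : cls (add2 x y) = cls x + cls y :> mhom l a b.
Proof. by rewrite -addhE. Qed.
Lemma clsZ c x : cls (scale2 c x) = c *: cls x :> mhom l a b.
Proof. by rewrite -scalehE. Qed.
Lemma cls_sum (T : Type) (r : seq T) (f : T -> mor2 k l a b) :
  cls (sum2 r f) = \sum_(t <- r) cls (f t).
Proof. by elim: r => [|t r IH]; rewrite ?big_nil ?big_cons // -IH -clsD. Qed.

End HomModule.

Lemma tgt_cat (l : P) (a b : wd) : tgt l (a ++ b) = tgt (tgt l b) a.
Proof. by elim: a => //= -[] i a ->. Qed.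

Lemma even_sgn b : gr false (sgn k b).
Proof.
rewrite /sgn; case: b; last by rewrite expr0; apply: gr1.
by rewrite expr1 -sub0r; apply: grB; [apply: gr0 | apply: gr1].
Qed.

Lemma sgn_sq b : sgn k b * sgn k b = 1.
Proof. by rewrite /sgn; case: b; rewrite ?expr1 ?mulrNN mulr1. Qed.

Section Operations.
Variable l : P.
Implicit Types a b c : wd.

Definition cmp a b c (Y : mhom l b c) (X : mhom l a b) : mhom l a c :=
  cls (vcomp (crep Y) (crep X)).
Definition idh a : mhom l a a := cls (id2 a).
Local Notation "y \ov x" := (cmp y x) (at level 39, left associativity).

Definition hmul (m : P) a b a' b' (Y : mhom m a' b') (X : mhom l a b)
  (e : m = tgt l a) : mhom l (a' ++ a) (b' ++ b) :=
    cls (hcomp (crep Y) (crep X) e).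

Lemma cmpE a b c (y : mor2 k l b c) (x : mor2 k l a b) :
  cls y \ov cls x = cls (vcomp y x).
Proof. by apply/cls_eq/eq2_vcomp; apply: crep_cls. Qed.

Lemma hmulE m a b a' b' (y : mor2 k m a' b') (x : mor2 k l a b) e :
  hmul (cls y) (cls x) e = cls (hcomp y x e).
Proof. by apply/cls_eq/eq2_hcomp; apply: crep_cls. Qed.

Lemma cmpA a b c d (Z : mhom l c d) (Y : mhom l b c) (X : mhom l a b) :
  Z \ov (Y \ov X) = Z \ov Y \ov X.
Proof.
case: (homP X) (homP Y) (homP Z) => [x ->] [y ->] [z ->].
by rewrite !cmpE; apply/cls_eq/eq2_vA.
Qed.
Lemma cmp1l a b (X : mhom l a b) : idh b \ov X = X.
Proof. by case: (homP X) => x ->; rewrite cmpE; apply/cls_eq/eq2_v1l. Qed.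
Lemma cmp1r a b (X : mhom l a b) : X \ov idh a = X.
Proof. by case: (homP X) => x ->; rewrite cmpE; apply/cls_eq/eq2_v1r. Qed.
Lemma cmpDl a b c (X : mhom l a b) : {morph (fun Y : mhom l b c =>
  Y \ov X) : Y Y' / Y + Y'}.
Proof.
move=> Y Y'; case: (homP X) (homP Y) (homP Y') => [x ->] [y ->] [y' ->].
by rewrite -clsD !cmpE -clsD; apply/cls_eq/eq2_vDl.
Qed.
Lemma cmpDr a b c (Y : mhom l b c) : {morph (fun X : mhom l a b =>
  Y \ov X) : X X' / X + X'}.
Proof.
move=> X X'; case: (homP X) (homP Y) (homP X') => [x ->] [y ->] [x' ->].
by rewrite -clsD !cmpE -clsD; apply/cls_eq/eq2_vDr.
Qed.
Lemma cmpZl a b c d (Y : mhom l b c) (X : mhom l a b) :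
  (d *: Y) \ov X = d *: (Y \ov X).
Proof.
case: (homP X) (homP Y) => [x ->] [y ->].
by rewrite -clsZ !cmpE -clsZ; apply/cls_eq/eq2_vZl.
Qed.

Lemma hmulDl m a b a' b' (X : mhom l a b) e :
  {morph (fun Y : mhom m a' b' => hmul Y X e) : Y Y' / Y + Y'}.
Proof.
move=> Y Y'; case: (homP X) (homP Y) (homP Y') => [x ->] [y ->] [y' ->].
by rewrite -clsD !hmulE -clsD; apply/cls_eq/eq2_hDl.
Qed.
Lemma hmulDr m a b a' b' (Y : mhom m a' b') e :
  {morph (fun X : mhom l a b => hmul Y X e) : X X' / X + X'}.
Proof.
move=> X X'; case: (homP X) (homP Y) (homP X') => [x ->] [y ->] [x' ->].
by rewrite -clsD !hmulE -clsD; apply/cls_eq/eq2_hDr.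
Qed.
Lemma hmulZl m a b a' b' d (Y : mhom m a' b') (X : mhom l a b) e :
  hmul (d *: Y) X e = d *: hmul Y X e.
Proof.
case: (homP X) (homP Y) => [x ->] [y ->].
by rewrite -clsZ !hmulE -clsZ; apply/cls_eq/eq2_hZl.
Qed.

Section Additive.
Variables (U V : zmodType) (f : U -> V).
Hypothesis fD : {morph f : x y / x + y}.
Lemma morph0 : f 0 = 0.
Proof. by apply: (addrI (f 0)); rewrite -fD !addr0. Qed.
Lemma morphN x : f (- x) = - f x.
Proof. by apply: (addrI (f x)); rewrite -fD !subrr morph0. Qed.
Lemma morphB x y : f (x - y) = f x - f y.
Proof. by rewrite fD morphN. Qed.
Lemma morph_sum (T : Type) (r : seq T) (p : pred T) (g : T -> U) :
  f (\sum_(t <- r | p t) g t) = \sum_(t <- r | p t) f (g t).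
Proof. exact: (big_morph f fD morph0). Qed.
End Additive.

Definition cmp0l a b c X := morph0 (@cmpDl a b c X).
Definition cmp0r a b c Y := morph0 (@cmpDr a b c Y).
Definition cmpNl a b c X := morphN (@cmpDl a b c X).
Definition cmpNr a b c Y := morphN (@cmpDr a b c Y).
Definition cmpBl a b c X := morphB (@cmpDl a b c X).
Definition cmpBr a b c Y := morphB (@cmpDr a b c Y).
Definition cmp_suml a b c X := morph_sum (@cmpDl a b c X).
Definition cmp_sumr a b c Y := morph_sum (@cmpDr a b c Y).

End Operations.

End Quotient.

Local Notation "y \ov x" := (cmp y x) (at level 39, left associativity).

(** * Whiskering and naturality *)

Section Whiskering.
Variables (R : realType) (I : eqType) (D : super_cartan I).
Variables (H : realization R D).
Implicit Types (l m : weight H) (a b c u v w : seq (letter I)).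
Variables (k : unitRingType) (gr : supercommutative k) (Q : parameters gr D).

Local Notation P := (weight H).
Local Notation wd := (seq (letter I)).
Local Notation mhom := (mhom Q).
Local Notation sgn := (sgn k).
Local Notation cls := (cls Q).

Section Homogeneous.
Variable l : P.

Definition hhom a b (p : bool) (X : mhom l a b) : Prop :=
  exists2 x, homog gr p x & X = cls x.

Lemma hhom_cls a b p (x : mor2 k l a b) : homog gr p x -> hhom p (cls x).
Proof. by exists x. Qed.

Lemma hhomD a b p (X Y : mhom l a b) : hhom p X -> hhom p Y -> hhom p (X + Y).
Proof.
move=> [x hx ->] [y hy ->]; exists (add2 x y); first exact: homog_add.
by rewrite clsD.
Qed.

Lemma hhomZ a b p q d (X : mhom l a b) : gr p d -> hhom q X ->
  hhom (p (+) q) (d *: X).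
Proof.
move=> gd [x hx ->]; exists (scale2 d x); first exact: homog_scale.
by rewrite clsZ.
Qed.

Lemma hhom_cmp a b c p q (Y : mhom l b c) (X : mhom l a b) :
  hhom p Y -> hhom q X -> hhom (p (+) q) (Y \ov X).
Proof.
move=> [y hy ->] [x hx ->]; exists (vcomp y x); first exact: homog_vcomp.
by rewrite cmpE.
Qed.

Lemma hhom_mul m a b a' b' p q (Y : mhom m a' b') (X : mhom l a b) e :
  (exists2 y, homog gr p y & Y = cls y) -> hhom q X ->
    hhom (p (+) q) (hmul Y X e).
Proof.
move=> [y hy ->] [x hx ->]; exists (hcomp y x e); first exact: homog_hcomp.
by rewrite hmulE.
Qed.

Lemma hhom_id a : hhom false (idh Q l a).
Proof. by exists (id2 a) => //; apply: homog_id. Qed.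

Lemma hhom0 a b p : hhom p (0 : mhom l a b).
Proof. by exists zero2 => //; apply: homog_zero. Qed.

Lemma cmpZr a b c p q d (Y : mhom l b c) (X : mhom l a b) :
  gr p d -> hhom q Y -> Y \ov (d *: X) = (sgn (p && q) * d) *: (Y \ov X).
Proof.
case: (homP X) => x -> gd [y hy ->].
by rewrite -clsZ !cmpE -clsZ; apply/cls_eq/eq2_vZr.
Qed.

Lemma interchange m a b c a' b' c' p q (V : mhom m b' c') (U : mhom l b c)
    (Y : mhom m a' b') (X : mhom l a b) (e : m = tgt l a) (e' : m = tgt l b) :
  hhom p U -> (exists2 y, homog gr q y & Y = cls y) ->
  hmul V U e' \ov hmul Y X e = sgn (p && q) *: hmul (V \ov Y) (U \ov X) e.
Proof.
case: (homP V) (homP X) => [v ->] [x ->] [u hu ->] [y hy ->].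
by rewrite !(hmulE, cmpE) -clsZ; apply/cls_eq/eq2_interchange.
Qed.

End Homogeneous.

Definition split_homog l a b (X : mhom l a b) :=
  exists X0 X1, [/\ hhom false X0, hhom true X1 & X = X0 + X1].

Lemma homog_split l a b p (X : mhom l a b) : hhom p X -> split_homog X.
Proof.
case: p => hX; [exists 0, X | exists X, 0];
  by split=> //; rewrite ?add0r ?addr0 //; apply: hhom0.
Qed.

Lemma split_homogD l a b (X Y : mhom l a b) :
  split_homog X -> split_homog Y -> split_homog (X + Y).
Proof.
move=> [X0 [X1 [h0 h1 ->]]] [Y0 [Y1 [g0 g1 ->]]]; exists (X0 + Y0), (X1 + Y1).
by split; [apply: hhomD | apply: hhomD | rewrite addrACA].
Qed.

(** Induction on formal 2-morphisms, with scalars split by [gr_gen]. It frees a sign rule of one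
    homogeneity hypothesis whenever the other factor is even. *)
Lemma homog_decomp l a b (X : mhom l a b) : split_homog X.
Proof.
case: (homP X) => x -> {X}; elim: {l a b} x.
- by move=> l a; apply: homog_split (hhom_id _ _).
- by move=> l a b; apply: homog_split (hhom0 _ _ _ false).
- by move=> l a b x hx y hy; rewrite clsD; apply: split_homogD.
- move=> l a b c x [X0 [X1 [h0 h1 e]]]; rewrite clsZ e.
  have [c0 [c1 [g0 g1 ->]]] := gr_gen gr c.
  rewrite scalerDr !scalerDl; do ?apply: split_homogD;
  by [ apply: homog_split (hhomZ g0 h0) | apply: homog_split (hhomZ g1 h0)
     | apply: homog_split (hhomZ g0 h1) | apply: homog_split (hhomZ g1 h1)].
- move=> l a b c y [Y0 [Y1 [h0 h1 e]]] x [X0 [X1 [g0 g1 e']]].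
  rewrite -cmpE e e' cmpDl !cmpDr; do ?apply: split_homogD;
  by [ apply: homog_split (hhom_cmp h0 g0) | apply: homog_split (hhom_cmp h0 g1)
     | apply: homog_split (hhom_cmp h1 g0)
       | apply: homog_split (hhom_cmp h1 g1)].
- move=> l m a b a' b' y [Y0 [Y1 [h0 h1 e]]] x [X0 [X1 [g0 g1 e']]] em.
  rewrite -hmulE e e' hmulDl !hmulDr; do ?apply: split_homogD;
  by [ apply: homog_split (hhom_mul em h0 g0)
    | apply: homog_split (hhom_mul em h0 g1)
     | apply: homog_split (hhom_mul em h1 g0)
       | apply: homog_split (hhom_mul em h1 g1)].
- by move=> i l; apply: homog_split (hhom_cls (homog_dot gr i l)).
- by move=> i j l; apply: homog_split (hhom_cls (homog_tau gr i j l)).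
- by move=> i l; apply: homog_split (hhom_cls (homog_eta gr i l)).
- by move=> i l; apply: homog_split (hhom_cls (homog_eps gr i l)).
- by move=> i j l; apply: homog_split (hhom_cls (homog_sinv gr i j l)).
- by move=> i l n; apply: homog_split (hhom_cls (homog_del gr n)).
- by move=> i l n; apply: homog_split (hhom_cls (homog_gam gr n)).
Qed.

Lemma cmpZr_even l a b c d (Y : mhom l b c) (X : mhom l a b) :
  gr false d -> Y \ov (d *: X) = d *: (Y \ov X).
Proof.
move=> gd; have [Y0 [Y1 [h0 h1 ->]]] := homog_decomp Y.
by rewrite !cmpDl scalerDr (cmpZr _ gd h0) (cmpZr _ gd h1)
  /Defs.sgn /= expr0 !mul1r.
Qed.

(* This makes naturality hold without hypotheses on the target weights. *)
Lemma cmp_tgt0 l a b (X : mhom l a b) : tgt l a <> tgt l b -> X = 0.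
Proof.
case: (homP X) => x -> {X}; elim: {l a b} x => //=.
- by move=> l a b x hx y hy /[dup]/hx ex /hy ey; rewrite clsD ex ey addr0.
- by move=> l a b c x hx /hx ex; rewrite clsZ ex scaler0.
(* The target weight changes in one of the two factors, and that factor is zero. *)
- move=> l a b c y hy x hx ne; rewrite -cmpE.
  have [e|/hx ->] := pselect (tgt l a = tgt l b); last by rewrite cmp0r.
  by rewrite hy ?cmp0l // -e.
- move=> l m a b a' b' y hy x hx em; rewrite !tgt_cat -hmulE => ne.
  have [e|/hx ->] := pselect (tgt l a = tgt l b); last first.
    by rewrite (morph0 (hmulDr _ _)).
  by rewrite hy ?(morph0 (hmulDl _ _)) // em => e'; apply: ne; rewrite e' e.
- by move=> i j l []; rewrite addrAC.
- by move=> i l []; rewrite addrK.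
- by move=> i l []; rewrite subrK.
- by move=> i j l []; rewrite addrAC.
- by move=> i l n []; rewrite subrK.
- by move=> i l n []; rewrite addrK.
Qed.

Lemma interchange_evl l m a b c a' b' c' (V : mhom m b' c') (U : mhom l b c)
    (Y : mhom m a' b') (X : mhom l a b) (e : m = tgt l a) (e' : m = tgt l b) :
  hhom false U ->
  hmul V U e' \ov hmul Y X e = hmul (V \ov Y) (U \ov X) e.
Proof.
move=> hU; have [Y0 [Y1 [h0 h1 ->]]] := homog_decomp Y.
rewrite hmulDl !cmpDr hmulDl (interchange V X e e' hU h0)
  (interchange V X e e' hU h1).
by rewrite /Defs.sgn /= expr0 !scale1r.
Qed.

Lemma interchange_evr l m a b c a' b' c' (V : mhom m b' c') (U : mhom l b c)
    (Y : mhom m a' b') (X : mhom l a b) (e : m = tgt l a) (e' : m = tgt l b) :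
  hhom false Y ->
  hmul V U e' \ov hmul Y X e = hmul (V \ov Y) (U \ov X) e.
Proof.
move=> hY; have [U0 [U1 [h0 h1 ->]]] := homog_decomp U.
rewrite hmulDr !cmpDl hmulDr (interchange V X e e' h0 hY)
  (interchange V X e e' h1 hY).
by rewrite /Defs.sgn /= expr0 !scale1r.
Qed.

Definition wh (s : letter I) l a b (X : mhom l a b) : mhom l (s :: a) (s :: b) :=
  hmul (idh Q (tgt l a) [:: s]) X erefl.

Lemma whE s l m a b (X : mhom l a b) (e : m = tgt l a) :
  wh s X = hmul (idh Q m [:: s]) X e.
Proof. by subst m. Qed.

Lemma wh_id s l a : wh s (idh Q l a) = idh Q l (s :: a).
Proof. by rewrite /wh hmulE; apply/cls_eq; apply: (eq2_h1 Q [:: s] erefl). Qed.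

Lemma whD s l a b : {morph (@wh s l a b) : X Y / X + Y}.
Proof. by move=> X Y; rewrite /wh hmulDr. Qed.

Lemma wh_cmp s l a b c (Y : mhom l b c) (X : mhom l a b) :
  wh s (Y \ov X) = wh s Y \ov wh s X.
Proof.
(* Interchange needs the same weight at both ends of [X]; otherwise [X] is zero. *)
have [e|ne] := pselect (tgt l a = tgt l b); last first.
  by rewrite [X]cmp_tgt0 // cmp0r !(morph0 (@whD s _ _ _)) cmp0r.
have h := interchange_evr (idh Q _ [:: s]) Y X erefl e (hhom_id (tgt l a)
  [:: s]).
by rewrite (whE s Y e) (whE s X erefl) [RHS]h cmp1l.
Qed.

Lemma whZ s l a b d (X : mhom l a b) : gr false d ->
  wh s (d *: X) = d *: wh s X.
Proof.
move=> gd; case: (homP X) => x ->; rewrite /wh -clsZ !hmulE -clsZ.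
have := homog_id gr (tgt l a) [:: s] => /(eq2_hZr Q erefl x gd) h.
by apply/cls_eq; move: h; rewrite /Defs.sgn /= expr0 mul1r.
Qed.

Lemma hhom_wh s l a b p (X : mhom l a b) : hhom p X -> hhom p (wh s X).
Proof.
move=> hX; rewrite -[p]addFb.
exact: (hhom_mul erefl (hhom_id (tgt l a) [:: s]) hX).
Qed.

Fixpoint whs (u : wd) l a b (X : mhom l a b) : mhom l (u ++ a) (u ++ b) :=
  if u is s :: v then wh s (whs v X) else X.

(** On concrete words the equalities in [eq2_hA] have convertible sides, and casts along such loops
    are trivial by proof irrelevance. *)
Lemma eq2_loop l a b (ea : a = a) (eb : b = b) (x y : mor2 k l a b) :
  eq2 Q (cast2 ea eb x) y -> eq2 Q x y.
Proof. by rewrite (Prop_irrelevance ea erefl) (Prop_irrelevance eb erefl). Qed.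

Lemma eq2_castK l a b a' b' (ea : a = a') (eb : b = b') (x : mor2 k l a b) y :
  eq2 Q (cast2 ea eb x) y -> eq2 Q x (cast2 (esym ea) (esym eb) y).
Proof. by subst a' b'. Qed.

Lemma whsE u l m a b (X : mhom l a b) (e : m = tgt l a) :
  whs u X = hmul (idh Q m u) X e.
Proof.
case: (homP X) => x ->; elim: u => [|s u IH] /=.
  by rewrite hmulE; apply/esym/cls_eq/eq2_h1l.
rewrite IH !hmulE /wh hmulE.
have en : tgt l (u ++ a) = tgt m u by rewrite tgt_cat e.
transitivity (cls (hcomp (hcomp (id2 [:: s]) (id2 u) en) x e)).
  apply/cls_eq; apply: (eq2_loop (ea := catA [:: s] u a)
  (eb := catA [:: s] u b)).
  exact: (eq2_hA Q e en erefl (id2 [:: s]) (id2 u) x).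
by apply/cls_eq; exact: (eq2_hcomp e (eq2_h1 Q [:: s] en) (eq2_refl Q x)).
Qed.

Section Tails.
Variable l : P.

(* tl g is g (x) id_w.  On concrete words the types of wh and tl agree by
   computation, so that no associativity cast of eq2_hA is needed. *)
Definition tl (w : wd) a b (g : mor2 k (tgt l w) a b) : mhom l (a ++ w)
  (b ++ w) :=
  hmul (cls g) (idh Q l w) erefl.

Lemma tlE w a b (g : mor2 k (tgt l w) a b) : tl g = cls (g \oh id2 w).
Proof. by rewrite /tl /idh hmulE. Qed.

Lemma tl_family w m a b (g : forall m, mor2 k m a b) (e : m = tgt l w) :
  tl (g (tgt l w)) = hmul (cls (g m)) (idh Q l w) e.
Proof. by subst m. Qed.

Lemma tl_eq w a b (g g' : mor2 k (tgt l w) a b) : eq2 Q g g' -> tl g = tl g'.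
Proof. by move=> /cls_eq e; rewrite /tl e. Qed.

Lemma tlD w a b (g g' : mor2 k (tgt l w) a b) : tl (add2 g g') = tl g + tl g'.
Proof. by rewrite /tl clsD hmulDl. Qed.

Lemma tlZ w a b d (g : mor2 k (tgt l w) a b) : tl (scale2 d g) = d *: tl g.
Proof. by rewrite /tl clsZ hmulZl. Qed.

Lemma tl0 w a b : tl (@zero2 _ _ _ _ _ (tgt l w) a b) = 0.
Proof. by rewrite /tl (morph0 (hmulDl _ _)). Qed.

Lemma tl_sum w a b (T : Type) (r : seq T) (g : T -> mor2 k (tgt l w) a b) :
  tl (sum2 r g) = \sum_(t <- r) tl (g t).
Proof. by rewrite /tl cls_sum (morph_sum (hmulDl _ _)). Qed.

Lemma tl_id w a : tl (id2 a) = idh Q l (a ++ w).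
Proof. by rewrite /tl hmulE; apply/cls_eq/eq2_h1. Qed.

Lemma tl_cmp w a b c (g : mor2 k (tgt l w) b c) (f : mor2 k (tgt l w) a b) :
  tl (vcomp g f) = tl g \ov tl f.
Proof.
rewrite /tl interchange_evl; last exact: hhom_id.
by rewrite cmpE cmp1l.
Qed.

Lemma hhom_tl w a b p (g : mor2 k (tgt l w) a b) : homog gr p g ->
  hhom p (tl g).
Proof.
move=> hg; rewrite -[p]addbF; apply: hhom_mul; last exact: hhom_id.
exact: hhom_cls.
Qed.

Lemma tl_wh w a b s (g : mor2 k (tgt l w) a b) :
  tl (id2 [:: s] \oh g) = wh s (tl g).
Proof.
have e : tgt (tgt l w) a = tgt l (a ++ w) by rewrite tgt_cat.
rewrite (whE s (tl g) e) !tlE /idh hmulE; apply/esym/cls_eq.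
apply: (eq2_loop (ea := catA [:: s] a w) (eb := catA [:: s] b w)).
exact: (eq2_hA Q erefl erefl e (id2 [:: s]) g (id2 w)).
Qed.

Lemma tl_hcomp w a b c d (g : mor2 k (tgt (tgt l w) a) c d)
  (f : mor2 k (tgt l w) a b)
    (e : tgt (tgt l w) a = tgt (tgt l w) b) :
  tl (g \oh f) = tl (hcomp g (id2 b) e) \ov tl (id2 c \oh f).
Proof.
rewrite -tl_cmp; apply: tl_eq; apply/cls_eq.
rewrite -cmpE -!hmulE interchange_evl; last exact: hhom_id.
by rewrite !cmpE; congr hmul; apply/cls_eq; apply: eq2_sym;
  [apply: eq2_v1r | apply: eq2_v1l].
Qed.

Definition casth a b a' b' (ea : a = a') (eb : b = b') (X : mhom l a b)
  : mhom l a' b' :=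
  ecast z (mhom l z b') ea (ecast z (mhom l a z) eb X).

Lemma casth_loop a b (ea : a = a) (eb : b = b) (X : mhom l a b)
  : casth ea eb X = X.
Proof. by rewrite (Prop_irrelevance ea erefl) (Prop_irrelevance eb erefl). Qed.

Lemma casth_cls a b a' b' (ea : a = a') (eb : b = b') x : casth ea eb (cls x)
  = cls (cast2 ea eb x).
Proof. by subst a' b'. Qed.

(** Associativity absorbs the identity of [v] into the tail. The family [g] is there because the
    weights over which it is taken on the two sides agree only propositionally. *)
Lemma tl_tail w v a b (g : forall m, mor2 k m a b) (x : mor2 k (tgt l w) v v) :
  eq2 Q x (id2 v) ->
  tl (g _ \oh x) = casth (catA a v w) (catA b v w) (tl (w := v ++ w) (g _)).
Proof.
move=> /cls_eq ex.
have e : tgt (tgt l w) v = tgt l (v ++ w) by rewrite tgt_cat.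
have -> : tl (g _ \oh x) = tl (g _ \oh id2 v).
  by rewrite /tl -!hmulE ex.
rewrite (tl_family g e) -tl_id !tlE hmulE casth_cls; apply/esym/cls_eq.
exact: eq2_hA.
Qed.

Lemma whs0 u w w' : whs u (0 : mhom l w w') = 0.
Proof. by elim: u => //= s u ->; rewrite (morph0 (@whD _ _ _ _)). Qed.

(** Both composites equal the horizontal product of [g] and [f], one of them up to the sign of the
    super interchange law. If [f] changes the weight, it is zero. *)
Lemma tl_natural w w' a b p q (g : forall m, mor2 k m a b) (f : mhom l w w') :
  (forall m, homog gr q (g m)) -> hhom p f ->
  tl (g (tgt l w')) \ov whs a f = sgn (p && q) *: (whs b f
    \ov tl (g (tgt l w))).
Proof.
move=> hg hf; have [e|ne] := pselect (tgt l w = tgt l w'); last first.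
  by rewrite [f]cmp_tgt0 // !whs0 cmp0r cmp0l scaler0.
rewrite (tl_family g e) (tl_family g erefl) (whsE a f erefl) (whsE b f erefl).
rewrite (interchange_evl _ _ _ _ _ (hhom_id _ _)).
rewrite (interchange _ _ _ _ hf (hhom_cls (hg _))) scalerA sgn_sq scale1r.
by rewrite !cmp1l !cmp1r.
Qed.

(** Evenness of [f] replaces homogeneity of [g]; the intended [g] is the bubble and the intended [f]
    a counit. *)
Lemma tl_natural_evenr w w' a b (g : forall m, mor2 k m a b) (f : mhom l w w') :
  hhom false f -> tl (g (tgt l w')) \ov whs a f = whs b f \ov tl (g (tgt l w)).
Proof.
move=> hf; have [e|ne] := pselect (tgt l w = tgt l w'); last first.
  by rewrite [f]cmp_tgt0 // !whs0 cmp0r cmp0l.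
rewrite (tl_family g e) (tl_family g erefl) (whsE a f erefl) (whsE b f erefl).
rewrite (interchange_evl _ _ _ _ _ (hhom_id _ _))
  (interchange_evl _ _ _ _ _ hf).
by rewrite !cmp1l !cmp1r.
Qed.

Lemma tl_nil a b (g : mor2 k l a b) :
  tl (w := [::]) g = casth (esym (cats0 a)) (esym (cats0 b)) (cls g).
Proof.
rewrite casth_cls /tl hmulE; apply/cls_eq.
by apply: eq2_castK; apply: eq2_h1r.
Qed.

End Tails.

End Whiskering.

(** * Weights, units and signs *)

Section WeightArith.
Variables (R : realType) (I : eqType) (D : super_cartan I).
Variables (H : realization R D).
Implicit Types (m : weight H) (i j : I).

Lemma hwtE i m : m (coroot H i) = (hwt i m)%:~R :> R[i]%C.
Proof. by rewrite /hwt; case: cid. Qed.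

Lemma hwtDalpha i j m : hwt i (m + alpha H j) = hwt i m - dij D i j.
Proof.
apply: (@intr_inj R[i]%C); rewrite -hwtE rmorphB /= -hwtE.
by rewrite -(coroot_sroot H).
Qed.

Lemma hposP i m n : hwt i m = Posz n -> hpos i m = n /\ hneg i m = 0%N.
Proof. by rewrite /hpos /hneg => ->; case: n. Qed.

Lemma hnegP i m n : hwt i m = - Posz n -> hpos i m = 0%N /\ hneg i m = n.
Proof. by rewrite /hpos /hneg => ->; case: n. Qed.

End WeightArith.

Lemma scale_unit_inj (k : unitRingType) (V : lmodType k) (t : k) :
  t \is a GRing.unit -> injective ( *:%R t : V -> V).
Proof.
by move=> tu X Y /(congr1 ( *:%R t^-1)); rewrite !scalerA mulVr // !scale1r.
Qed.

Lemma scale_unit_inj0 (k : unitRingType) (V : lmodType k) (t : k) (X : V) :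
  t \is a GRing.unit -> t *: X = 0 -> X = 0.
Proof. by move=> tu; rewrite -[RHS in _ = RHS -> _](scaler0 V t) =>
  /(scale_unit_inj tu). Qed.

Lemma sgn_neg (k : unitRingType) b : sgn k (~~ b) = - sgn k b.
Proof. by rewrite /sgn; case: b; rewrite ?expr1 ?expr0 ?opprK. Qed.

Lemma sgn_unit (k : unitRingType) b : sgn k b \is a GRing.unit.
Proof. by rewrite /sgn unitrX ?unitrN1. Qed.

(** * Generators and relations on words *)

Section Generators.
Variables (R : realType) (I : eqType) (D : super_cartan I).
Variables (H : realization R D).
Variables (k : unitRingType) (gr : supercommutative k) (Q : parameters gr D).
Variable l : weight H.

Local Notation P := (weight H).
Local Notation wd := (seq (letter I)).
Local Notation hom := (mhom Q l).
Local Notation sgn := (sgn k).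
Local Notation id := (idh Q l).
Local Notation tl := (tl Q).
Implicit Types (u v w : wd) (i j : I).

Definition Xd i w : hom (E i :: w) (E i :: w) := tl (dot k i (tgt l w)).
Definition Tau i j w : hom (E i :: E j :: w) (E j :: E i :: w) :=
  tl (tau k i j (tgt l w)).
Definition Eta i w : hom w (F i :: E i :: w) := tl (eta k i (tgt l w)).
Definition Eps i w : hom (E i :: F i :: w) w := tl (eps k i (tgt l w)).
Definition Sinv i j w : hom (F i :: E j :: w) (E j :: F i :: w) :=
  tl (sinv k i j (tgt l w)).
Definition Sig j i w : hom (E j :: F i :: w) (F i :: E j :: w) :=
  tl (sigma k j i (l := tgt l w)).
Definition Xp i n w : hom (E i :: w) (E i :: w) := tl (xpow k i n
  (l := tgt l w)).
(* Indexing by nat instead of 'I_(hpos i m) makes del and gam families over all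
   weights, as tl_natural requires. *)
Definition del_nat i (m : P) (n : nat) : mor2 k m [::] [:: E i; F i] :=
  if insub n : option 'I_(hpos i m) is Some o then del k o else zero2.
Definition gam_nat i (m : P) (n : nat) : mor2 k m [:: F i; E i] [::] :=
  if insub n : option 'I_(hneg i m) is Some o then gam k o else zero2.
Definition Del i n w : hom w (E i :: F i :: w) := tl (del_nat i (tgt l w) n).
Definition Gam i n w : hom (F i :: E i :: w) w := tl (gam_nat i (tgt l w) n).

Definition Epsx i n w := Eps i w \ov Xp i n (F i :: w).
Definition Etax i n w := wh (F i) (Xp i n w) \ov Eta i w.

Lemma Xp0 i w : Xp i 0 w = id (E i :: w).
Proof. exact: (tl_id Q l w [:: E i]). Qed.
Lemma XpS i n w : Xp i n.+1 w = Xd i w \ov Xp i n w.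
Proof. exact: (tl_cmp Q (dot k i _) (xpow k i n)). Qed.
Lemma XpD i m n w : Xp i (m + n) w = Xp i m w \ov Xp i n w.
Proof.
elim: m => [|m IH]; first by rewrite Xp0 cmp1l.
by rewrite addSn !XpS IH cmpA.
Qed.
Lemma Xp1 i w : Xp i 1 w = Xd i w.
Proof. by rewrite XpS Xp0 cmp1r. Qed.
Lemma XpSr i n w : Xp i n.+1 w = Xp i n w \ov Xd i w.
Proof. by rewrite -addn1 XpD Xp1. Qed.

Lemma homog_xpow i n (m : P) : homog gr (odd n && par D i) (xpow k i n
  (l := m)).
Proof.
elim: n => [|n IH] /=; first exact: homog_id.
have -> : ~~ odd n && par D i = par D i (+) (odd n && par D i).
  by case: (odd n); case: (par D i).
exact: homog_vcomp (homog_dot _ _ _) IH.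
Qed.

Lemma homog_del_nat i (m : P) n : homog gr (odd n && par D i) (del_nat i m n).
Proof.
rewrite /del_nat; case: insubP => [o _ <-|_]; last exact: homog_zero.
exact: homog_del.
Qed.

Lemma homog_gam_nat i (m : P) n : homog gr (odd n && par D i) (gam_nat i m n).
Proof.
rewrite /gam_nat; case: insubP => [o _ <-|_]; last exact: homog_zero.
exact: homog_gam.
Qed.

Lemma homog_sigma j i (m : P) : homog gr (par D i && par D j)
  (sigma k j i (l := m)).
Proof.
have idh (l' : P) s := homog_id gr l' [:: s : letter I].
have := homog_vcomp (homog_vcomp
  (homog_hcomp erefl (idh _ (F i)) (homog_hcomp erefl (idh _ (E j))
    (homog_eps gr i m)))
  (homog_hcomp erefl (idh _ (F i)) (homog_hcomp erefl (homog_tau gr i j _)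
    (idh _ (F i)))))
  (homog_hcomp erefl (homog_eta gr i _) (homog_hcomp erefl (idh _ (E j))
    (idh m (F i)))).
by rewrite /= !addbF; exact.
Qed.

Lemma hhom_Dot i w : hhom (par D i) (Xd i w).
Proof. exact: (hhom_tl Q (homog_dot gr i _)). Qed.
Lemma hhom_Xp i n w : hhom (odd n && par D i) (Xp i n w).
Proof. exact: (hhom_tl Q (homog_xpow i n _)). Qed.
Lemma hhom_Eta i w : hhom false (Eta i w).
Proof. exact: (hhom_tl Q (homog_eta gr i _)). Qed.
Lemma hhom_Eps i w : hhom false (Eps i w).
Proof. exact: (hhom_tl Q (homog_eps gr i _)). Qed.
Lemma hhom_Sinv i j w : hhom (par D i && par D j) (Sinv i j w).
Proof. exact: (hhom_tl Q (homog_sinv gr i j _)). Qed.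
Lemma hhom_Sig j i w : hhom (par D i && par D j) (Sig j i w).
Proof. exact: (hhom_tl Q (homog_sigma j i _)). Qed.
Lemma hhom_Del i n w : hhom (odd n && par D i) (Del i n w).
Proof. exact: (hhom_tl Q (homog_del_nat i _ n)). Qed.

Lemma tl_natural_even w w' a b (g : forall m, mor2 k m a b) (f : hom w w') :
  (forall m, homog gr false (g m)) ->
  tl (g (tgt l w')) \ov whs a f = whs b f \ov tl (g (tgt l w)).
Proof.
move=> hg; have [f0 [f1 [h0 h1 ->]]] := homog_decomp f.
have whsD u : {morph (@whs _ _ _ _ _ _ Q u l w w') : X Y / X + Y}.
  by move=> X Y; elim: u => //= s u ->; rewrite whD.
rewrite !whsD cmpDr cmpDl (tl_natural hg h0) (tl_natural hg h1).
by rewrite /Defs.sgn !expr0 !scale1r.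
Qed.

Section Naturality.
Variables (w w' : wd).

Lemma Eta_nat i (f : hom w w') : Eta i w' \ov f = wh (F i) (wh (E i) f)
  \ov Eta i w.
Proof. exact: (tl_natural_even f (fun m => homog_eta gr i m)). Qed.

Lemma Eps_nat i (f : hom w w') : Eps i w' \ov wh (E i) (wh (F i) f) = f
  \ov Eps i w.
Proof. exact: (tl_natural_even f (fun m => homog_eps gr i m)). Qed.

Variables (p : bool) (f : hom w w').
Hypothesis hf : hhom p f.

Lemma Dot_nat i :
  Xd i w' \ov wh (E i) f = sgn (p && par D i) *: (wh (E i) f \ov Xd i w).
Proof. exact: (tl_natural (fun m => homog_dot gr i m) hf). Qed.

Lemma Xp_nat i n :
  Xp i n w' \ov wh (E i) f = sgn (p && (odd n && par D i)) *: (wh (E i)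
    f \ov Xp i n w).
Proof. exact: (tl_natural (g := fun m => @xpow _ _ _ _ k i n m) (fun m =>
  homog_xpow i n m) hf). Qed.

Lemma Tau_nat i j :
  Tau i j w' \ov wh (E i) (wh (E j) f)
  = sgn (p && (par D i && par D j)) *: (wh (E j) (wh (E i) f) \ov Tau i j w).
Proof. exact: (tl_natural (fun m => homog_tau gr i j m) hf). Qed.

Lemma Sinv_nat i j :
  Sinv i j w' \ov wh (F i) (wh (E j) f)
  = sgn (p && (par D i && par D j)) *: (wh (E j) (wh (F i) f) \ov Sinv i j w).
Proof. exact: (tl_natural (fun m => homog_sinv gr i j m) hf). Qed.

Lemma Sig_nat j i :
  Sig j i w' \ov wh (E j) (wh (F i) f)
  = sgn (p && (par D i && par D j)) *: (wh (F i) (wh (E j) f) \ov Sig j i w).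
Proof. exact: (tl_natural (g := fun m => @sigma _ _ _ _ k j i m) (fun m =>
  homog_sigma j i m) hf). Qed.

Lemma Del_nat i n :
  Del i n w' \ov f
  = sgn (p && (odd n && par D i)) *: (wh (E i) (wh (F i) f) \ov Del i n w).
Proof. exact: (tl_natural (g := fun m => del_nat i m n) (fun m =>
  homog_del_nat i m n) hf). Qed.

Lemma Gam_nat i n :
  Gam i n w' \ov wh (F i) (wh (E i) f)
  = sgn (p && (odd n && par D i)) *: (f \ov Gam i n w).
Proof. exact: (tl_natural (g := fun m => gam_nat i m n) (fun m =>
  homog_gam_nat i m n) hf). Qed.

End Naturality.

Section Relations.
Variable w : wd.

(** The two equalities are arbitrary so that [erefl] can be supplied on concrete words, where the
    cast disappears. *)
Lemma tl_loop a b v (g : forall m, mor2 k m a b) (x : mor2 k (tgt l w) v v)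
    (ea : a ++ v ++ w = (a ++ v) ++ w) (eb : b ++ v ++ w = (b ++ v) ++ w) :
  eq2 Q x (id2 v) -> tl (g _ \oh x) = casth ea eb (tl (w := v ++ w) (g _)).
Proof.
rewrite (Prop_irrelevance ea (catA a v w)) (Prop_irrelevance eb (catA b v w)).
exact: tl_tail.
Qed.

Lemma tl_Xp i n s : tl (w := w) (xpow k i n \oh id2 [:: s]) = Xp i n (s :: w).
Proof. exact: (@tl_loop _ _ [:: s] (fun m =>
  @xpow _ _ _ _ k i n m) _ erefl erefl (eq2_refl _ _)). Qed.
Lemma tl_Dot i s : tl (w := w) (dot k i _ \oh id2 [:: s]) = Xd i (s :: w).
Proof. exact: (@tl_loop _ _ [:: s] (fun m =>
  dot k i m) _ erefl erefl (eq2_refl _ _)). Qed.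
Lemma tl_Tau i j s : tl (w := w) (tau k i j _ \oh id2 [:: s])
  = Tau i j (s :: w).
Proof. exact: (@tl_loop _ _ [:: s] (fun m =>
  tau k i j m) _ erefl erefl (eq2_refl _ _)). Qed.
Lemma tl_Eps i s : tl (w := w) (eps k i _ \oh id2 [:: s]) = Eps i (s :: w).
Proof. exact: (@tl_loop _ _ [:: s] (fun m =>
  eps k i m) _ erefl erefl (eq2_refl _ _)). Qed.
Lemma tl_Eta i s : tl (w := w) (eta k i _ \oh id2 [:: s]) = Eta i (s :: w).
Proof. exact: (@tl_loop _ _ [:: s] (fun m =>
  eta k i m) _ erefl erefl (eq2_refl _ _)). Qed.
Lemma tl_Eta2 i s s' :
  tl (w := w) (eta k i _ \oh id2 [:: s] \oh id2 [:: s']) = Eta i (s :: s' :: w).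
Proof.
exact: (@tl_loop _ _ [:: s; s'] (fun m =>
  eta k i m) _ erefl erefl (eq2_h1 Q (a := [:: s']) [:: s] erefl)).
Qed.

Lemma tl_XX i j p q : tl (w := w) (xpow k i p \oh xpow k j q)
  = Xp i p (E j :: w) \ov wh (E i) (Xp j q w).
Proof.
have := tl_hcomp Q (xpow k i p) (xpow k j q (l := tgt l w)) erefl.
by rewrite tl_Xp tl_wh.
Qed.

Lemma zigzagE i : Eps i (E i :: w) \ov wh (E i) (Eta i w) = id (E i :: w).
Proof.
have := tl_eq (eq2_zigzagE Q i (tgt l w)).
by rewrite tl_cmp tl_Eps tl_wh tl_id.
Qed.

Lemma zigzagF i : wh (F i) (Eps i w) \ov Eta i (F i :: w) = id (F i :: w).
Proof.
have := tl_eq (eq2_zigzagF Q i (tgt l w)).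
by rewrite tl_cmp tl_Eta tl_wh tl_id.
Qed.

Lemma SigE j i : Sig j i w =
  wh (F i) (wh (E j) (Eps i w)) \ov wh (F i) (Tau i j (F i :: w))
  \ov Eta i (E j :: F i :: w).
Proof. by rewrite /Sig /sigma !tl_cmp !tl_wh tl_Tau tl_Eta2. Qed.

Lemma TauK_diag i : Tau i i w \ov Tau i i w = 0.
Proof. by have := tl_eq (eq2_quad_diag Q i (tgt l w)); rewrite tl_cmp tl0. Qed.

Lemma TauK0 i j : dij D i j = 0 ->
  Tau j i w \ov Tau i j w = tij Q i j *: id (E i :: E j :: w).
Proof.
by move=> d0; have := tl_eq (eq2_quad_0 Q (tgt l w) d0);
  rewrite tl_cmp tlZ tl_id.
Qed.

Lemma TauK i j : i != j -> dij D i j != 0 ->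
  Tau j i w \ov Tau i j w =
    tij Q i j *: Xp i (dn D i j) (E j :: w) + tij Q j i *: wh (E i)
      (Xp j (dn D j i) w)
    + \sum_(p <- iota 1 (dn D i j).-1) \sum_(q <- iota 1 (dn D j i).-1)
        sij Q i j p q *: (Xp i p (E j :: w) \ov wh (E i) (Xp j q w)).
Proof.
move=> nij d0; have := tl_eq (eq2_quad Q (tgt l w) nij d0).
rewrite tl_cmp /quad_rhs !tlD !tlZ tl_wh tl_Xp tl_sum => h; rewrite [LHS]h;
  congr (_ + _).
apply: eq_bigr => p _; rewrite tl_sum; apply: eq_bigr => q _.
by rewrite tlZ tl_XX.
Qed.

Lemma TauDotl i j : i != j ->
  Tau i j w \ov Xd i (E j :: w) = sgn (par D i && par D j) *: (wh (E j)
    (Xd i w) \ov Tau i j w).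
Proof.
move=> nij; have := tl_eq (eq2_dotl Q (tgt l w) nij).
rewrite tlD tlZ !tl_cmp tl_Dot tl_wh tl0 scaleNr => /eqP.
by rewrite subr_eq0 => /eqP.
Qed.

Lemma TauDotr i j : i != j ->
  Xd j (E i :: w) \ov Tau i j w = sgn (par D i && par D j) *: (Tau i j w
    \ov wh (E i) (Xd j w)).
Proof.
move=> nij; have := tl_eq (eq2_dotr Q (tgt l w) nij).
rewrite tlD tlZ !tl_cmp tl_Dot tl_wh tl0 scaleNr => /eqP.
by rewrite subr_eq0 => /eqP.
Qed.

Lemma TauDotl_diag i :
  Tau i i w \ov Xd i (E i :: w) - sgn (par D i) *: (wh (E i) (Xd i w)
    \ov Tau i i w)
  = id (E i :: E i :: w).
Proof.
have := tl_eq (eq2_dotl_diag Q i (tgt l w)).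
by rewrite tlD tlZ !tl_cmp tl_Dot tl_wh tl_id scaleNr andbb.
Qed.

Lemma TauDotr_diag i :
  Xd i (E i :: w) \ov Tau i i w - sgn (par D i) *: (Tau i i w
    \ov wh (E i) (Xd i w))
  = id (E i :: E i :: w).
Proof.
have := tl_eq (eq2_dotr_diag Q i (tgt l w)).
by rewrite tlD tlZ !tl_cmp tl_Dot tl_wh tl_id scaleNr andbb.
Qed.

Definition Braid i j m : hom [:: E i, E j, E m & w] [:: E m, E j, E i & w] :=
  Tau j m (E i :: w) \ov wh (E j) (Tau i m w) \ov Tau i j (E m :: w)
  - wh (E m) (Tau i j w) \ov Tau i m (E j :: w) \ov wh (E i) (Tau j m w).

Lemma BraidE i j m : Braid i j m = tl (braid_lhs k i j m).
Proof. by rewrite tlD tlZ !tl_cmp !tl_wh !tl_Tau scaleN1r. Qed.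

Lemma Braid0 i j m : ~~ ((i == m) && (i != j)) -> Braid i j m = 0.
Proof. by move=> h; rewrite BraidE (tl_eq (eq2_braid Q _ h)) tl0. Qed.

Lemma tl_XidX i j r s q :
  tl (w := w) (xpow k i r \oh xpow k j q \oh xpow k i s)
  = Xp i r (E j :: E i :: w) \ov wh (E i) (Xp j q (E i :: w)
    \ov wh (E j) (Xp i s w)).
Proof.
have := tl_hcomp Q (xpow k i r) (xpow k j q \oh xpow k i s : mor2 k (tgt l w)
  _ _) erefl.
rewrite tl_wh tl_XX => h; rewrite [LHS]h; congr (_ \ov _).
exact: (@tl_loop _ _ [:: E j; E i] (fun m =>
  @xpow _ _ _ _ k i r m) _ erefl erefl (eq2_refl _ _)).
Qed.

Lemma tl_XEX i j r s :
  tl (w := w) (xpow k i r \oh id2 [:: E j] \oh xpow k i s)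
  = Xp i r (E j :: E i :: w) \ov wh (E i) (wh (E j) (Xp i s w)).
Proof. by have := tl_XidX i j r s 0; rewrite Xp0 cmp1l. Qed.

Lemma Braid_iji i j : i != j ->
  Braid i j i =
  \sum_(r <- iota 0 (dn D i j)) (sgn (par D i && (par D j (+)
    odd ((dn D i j).-1 - r)%N)) * tij Q i j) *:
     (Xp i r (E j :: E i :: w) \ov wh (E i) (wh (E j) (Xp i ((dn D i j).-1 - r)
       w)))
  + \sum_(p <- iota 1 (dn D i j).-1) \sum_(q <- iota 1 (dn D j i).-1)
    \sum_(r <- iota 0 p)
     (sgn (par D i && (par D j (+) odd (p.-1 - r)%N)) * sij Q i j p q) *:
     (Xp i r (E j :: E i :: w) \ov wh (E i) (Xp j q (E i :: w)
       \ov wh (E j) (Xp i (p.-1 - r) w))).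
Proof.
move=> nij; rewrite BraidE (tl_eq (eq2_braid_iji Q _ nij)) tlD !tl_sum;
  congr (_ + _).
  by apply: eq_bigr => r _; rewrite tlZ tl_XEX.
apply: eq_bigr => p _; rewrite tl_sum; apply: eq_bigr => q _; rewrite tl_sum.
by apply: eq_bigr => r _; rewrite tlZ tl_XidX.
Qed.

Local Notation hp i := (hpos i (tgt l w)).
Local Notation hn i := (hneg i (tgt l w)).

Lemma EpsxE i n : Epsx i n w = tl (epsx k i n).
Proof. by rewrite /epsx tl_cmp tl_Xp. Qed.
Lemma EtaxE i n : Etax i n w = tl (etax k i n).
Proof. by rewrite /etax tl_cmp tl_wh. Qed.

Lemma Del_ord i (n : 'I_(hp i)) : Del i n w = tl (del k n).
Proof. by rewrite /Del /del_nat valK. Qed.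
Lemma Gam_ord i (n : 'I_(hn i)) : Gam i n w = tl (gam k n).
Proof. by rewrite /Gam /gam_nat valK. Qed.

Lemma M_EF i :
  Sinv i i w \ov Sig i i w + \sum_(n < hp i) Del i n w
    \ov Epsx i n w = id (E i :: F i :: w).
Proof.
have := tl_eq (eq2_M_EF Q i (tgt l w)).
rewrite tl_id tlD tl_cmp tl_sum big_enum => h; rewrite -[RHS]h; congr (_ + _).
by apply: eq_bigr => n _; rewrite tl_cmp Del_ord EpsxE.
Qed.
Lemma M_FE i :
  Sig i i w \ov Sinv i i w + \sum_(n < hn i) Etax i n w
    \ov Gam i n w = id (F i :: E i :: w).
Proof.
have := tl_eq (eq2_M_FE Q i (tgt l w)).
rewrite tl_id tlD tl_cmp tl_sum big_enum => h; rewrite -[RHS]h; congr (_ + _).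
by apply: eq_bigr => n _; rewrite tl_cmp Gam_ord EtaxE.
Qed.

Lemma Sig_Del i n : (n < hp i)%N -> Sig i i w \ov Del i n w = 0.
Proof.
move=> ltn; have := tl_eq (eq2_M_sigma_del Q (Ordinal ltn)).
by rewrite tl_cmp -Del_ord tl0.
Qed.
Lemma Epsx_Del i m n : (m < hp i)%N -> (n < hp i)%N ->
  Epsx i m w \ov Del i n w = if m == n then id w else 0.
Proof.
move=> ltm ltn; have := tl_eq (eq2_M_eps_del Q (Ordinal ltm) (Ordinal ltn)).
by rewrite tl_cmp -EpsxE -Del_ord -val_eqE /=; case: eqP; rewrite (tl_id, tl0).
Qed.
Lemma Gam_Sig i n : (n < hn i)%N -> Gam i n w \ov Sig i i w = 0.
Proof.
move=> ltn; have := tl_eq (eq2_M_gam_sigma Q (Ordinal ltn)).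
by rewrite tl_cmp -Gam_ord tl0.
Qed.
Lemma Gam_Etax i m n : (m < hn i)%N -> (n < hn i)%N ->
  Gam i m w \ov Etax i n w = if m == n then id w else 0.
Proof.
move=> ltm ltn; have := tl_eq (eq2_M_gam_eta Q (Ordinal ltm) (Ordinal ltn)).
by rewrite tl_cmp -EtaxE -Gam_ord -val_eqE /=; case: eqP; rewrite (tl_id, tl0).
Qed.

End Relations.

(** * The odd bubble on words *)

Variable c : normalization H Q.
Local Notation par := (par D).
Local Notation dn := (dn D).
Local Notation h i w := (hwt i (tgt l w)).

Definition Bub i w : hom w w := tl (odd_bubble c i (tgt l w)).

Lemma tl_cw i n w :
  tl (cw c i n (l := tgt l w)) = Epsx i n w \ov tl (leta c i (l := tgt l w)).
Proof. by rewrite /cw !tl_cmp tl_Xp. Qed.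

Lemma tl_ccw i n w :
  tl (ccw c i n (l := tgt l w)) = tl (leps c i (l := tgt l w)) \ov Etax i n w.
Proof. by rewrite /ccw !tl_cmp tl_wh -cmpA. Qed.

(** For positive weight [leta] is [cnorm] times the last [del], and this unit cancels the inverse
    one in [odd_bubble]. *)
Lemma Bub_pos i w n : h i w = Posz n.+1 ->
  Bub i w = Epsx i n.+1 w \ov Del i n w.
Proof.
move=> hE; have [hpE _] := hposP hE.
rewrite /Bub /odd_bubble hE /= tlZ tl_cw /leta.
case: insubP => [o _ eo|]; last by rewrite hpE leqnn.
rewrite tlZ -Del_ord eo hpE /= cmpZr_even; last exact: cnorm_even.
by rewrite scalerA mulVr ?scale1r //; apply: cnorm_unit.
Qed.

Lemma Bub_neg i w n : h i w = - Posz n.+1 ->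
  Bub i w = Gam i n w \ov Etax i n.+1 w.
Proof.
move=> hE; have [_ hnE] := hnegP hE.
rewrite /Bub /odd_bubble hE /= tlZ tl_ccw /leps.
case: insubP => [o _ eo|]; last by rewrite hnE leqnn.
rewrite tlZ -Gam_ord eo hnE /= cmpZl.
by rewrite scalerA mulrV ?scale1r //; apply: cnorm_unit.
Qed.

(** For odd [i] at weight zero, [leta] carries the sign -1 and [ltau i i] another one, so no sign
    remains. *)
Lemma Bub0 i w : par i -> h i w = 0 ->
  Bub i w = Eps i w \ov Sinv i i w \ov Eta i w.
Proof.
move=> pi hE; have [hpE _] := hposP hE.
rewrite /Bub /odd_bubble hE /= tlZ tl_cw /leta.
case: insubP => [o|_]; first by rewrite [X in (_ < X)%N]hpE.
rewrite tlZ cmpZr_even; last first.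
  rewrite -[false]/(false (+) false); apply: grM; first exact: even_sgn.
  exact: cnorm_even.
rewrite tl_cmp /ltau eqxx tlZ cmpZl -EtaxE cmpZr_even; last first.
  exact: (even_sgn gr true).
rewrite hE pi /sgn /= expr1 !scalerA !(mulN1r, mulrN1, mulrN, mulNr, opprK)
  mulVr; last exact: cnorm_unit.
by rewrite scale1r /Epsx Xp0 cmp1r /Etax Xp0 wh_id cmp1l cmpA.
Qed.

Lemma sgn0 : sgn false = 1. Proof. by []. Qed.
Lemma sgn1 : sgn true = -1. Proof. by []. Qed.
Lemma sgnD (a b : bool) : sgn (a (+) b) = sgn a * sgn b.
Proof. by rewrite /Defs.sgn signr_addb. Qed.

Lemma wh0 s u v : wh s (0 : hom u v) = 0.
Proof. exact: (morph0 (@whD _ _ _ _ _ _ _ _ _ _ _)). Qed.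
Lemma wh_sum s u v (T : Type) (r : seq T) (p : pred T) (g : T -> hom u v) :
  wh s (\sum_(t <- r | p t) g t) = \sum_(t <- r | p t) wh s (g t).
Proof. exact: (morph_sum (@whD _ _ _ _ _ _ _ _ _ _ _)). Qed.
Lemma whB s u v (X Y : hom u v) : wh s (X - Y) = wh s X - wh s Y.
Proof. exact: (morphB (@whD _ _ _ _ _ _ _ _ _ _ _)). Qed.
Lemma wh_sgn s b u v (X : hom u v) : wh s (sgn b *: X) = sgn b *: wh s X.
Proof. by apply: whZ; apply: even_sgn. Qed.
Lemma cmpZr_sgn b u v w (Y : hom v w) (X : hom u v) :
  Y \ov (sgn b *: X) = sgn b *: (Y \ov X).
Proof. by apply: cmpZr_even; apply: even_sgn. Qed.

(** * Rotated relations *)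

(** Pitchfork relation: the cup inside [Sig] and the new cap form a zigzag. *)
Lemma Eps_Sig i j w :
  Eps i (E j :: w) \ov wh (E i) (Sig j i w) = wh (E j) (Eps i w)
    \ov Tau i j (F i :: w).
Proof.
rewrite SigE -wh_cmp wh_cmp cmpA Eps_nat -[LHS]cmpA.
by rewrite zigzagE cmp1r.
Qed.

(** The mirror pitchfork: here the cap inside [Sig] straightens against the new cup. *)
Lemma Sig_Eta i j w :
  Sig j i (E i :: w) \ov wh (E j) (Eta i w) = wh (F i) (Tau i j w)
    \ov Eta i (E j :: w).
Proof.
rewrite SigE -[LHS]cmpA Eta_nat cmpA -!wh_cmp -[_ \ov _ \ov wh _ _]cmpA.
by rewrite (Tau_nat (hhom_Eta i w))
  sgn0 scale1r cmpA -wh_cmp zigzagE wh_id cmp1l.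
Qed.

(** Rotation of the nilHecke dot relation; its identity term turns into a cap followed by a cup. *)
Lemma SigDot_diag i w :
  wh (F i) (Xd i w) \ov Sig i i w
  = sgn (par i) *: (Sig i i w \ov Xd i (F i :: w)) + Eta i w \ov Eps i w.
Proof.
have e : Xd i w \ov wh (E i) (Eps i w) = wh (E i) (Eps i w)
  \ov Xd i (E i :: F i :: w).
  by rewrite (Dot_nat (hhom_Eps i w)) sgn0 scale1r.
have t := TauDotr_diag (F i :: w) i.
have {}t : Xd i (E i :: F i :: w) \ov Tau i i (F i :: w) = id _
   + sgn (par i) *: (Tau i i (F i :: w) \ov wh (E i) (Xd i (F i :: w))).
  by rewrite -t addrNK.
rewrite SigE -!wh_cmp [LHS]cmpA -wh_cmp cmpA e -[X in wh _ X]cmpA t.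
rewrite cmpDr whD cmpDl cmp1r cmpZr_sgn wh_sgn cmpZl addrC -Eta_nat;
  congr (_ *: _ + _).
by rewrite -[RHS]cmpA Eta_nat [RHS]cmpA -wh_cmp cmpA.
Qed.

(** Two upward strands crossing one downward strand need only one cup and one cap: the inner pair is
    removed by [Eps_Sig], and the sign comes from interchanging a crossing with [Sig]. *)
Lemma Sig_Sig i j m w :
  Sig j i (E m :: w) \ov wh (E j) (Sig m i w) =
  sgn (par i && par m && (par i && par j)) *:
   (wh (F i) (wh (E j) (wh (E m) (Eps i w) \ov Tau i m (F i :: w))
     \ov Tau i j (E m :: F i :: w))
    \ov Eta i (E j :: E m :: F i :: w)).
Proof.
rewrite SigE -[LHS]cmpA Eta_nat cmpA -!wh_cmp -[_ \ov _ \ov wh _ _]cmpA.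
rewrite (Tau_nat (hhom_Sig m i w)) cmpZr_sgn wh_sgn cmpZl cmpA -wh_cmp.
by rewrite Eps_Sig.
Qed.

(** By [Sig_Sig] both composites are rotations with the same sign, so their difference is the
    rotation of [Braid]. *)
Lemma Sig_braid i j m w :
  wh (F i) (Tau j m w) \ov Sig j i (E m :: w) \ov wh (E j) (Sig m i w)
  - Sig m i (E j :: w) \ov wh (E m) (Sig j i w) \ov Tau j m (F i :: w)
  = sgn (par i && par m && (par i && par j)) *:
   (wh (F i) (wh (E m) (wh (E j) (Eps i w)) \ov Braid (F i :: w) i j m)
    \ov Eta i (E j :: E m :: F i :: w)).
Proof.
rewrite -[wh (F i) _ \ov _ \ov _]cmpA !Sig_Sig cmpZr_sgn cmpZl.
rewrite [par i && par m && _]andbC -scalerBr; congr (_ *: _).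
rewrite [X in X - _]cmpA -[X in X
  \ov _ - _]wh_cmp -[X in _ - X]cmpA Eta_nat [X in _ - X]cmpA.
rewrite -[X in _ - X \ov _]wh_cmp -cmpBl -whB.
congr (wh _ _ \ov _); rewrite /Braid cmpBr; congr (_ - _).
  rewrite wh_cmp !cmpA; congr (_ \ov _ \ov _).
  by rewrite (Tau_nat (hhom_Eps i w)) sgn0 scale1r.
by rewrite wh_cmp !cmpA.
Qed.

Lemma Sig_braid_diag i w :
  wh (F i) (Tau i i w) \ov Sig i i (E i :: w) \ov wh (E i) (Sig i i w)
  = Sig i i (E i :: w) \ov wh (E i) (Sig i i w) \ov Tau i i (F i :: w).
Proof.
apply/eqP; rewrite -subr_eq0 Sig_braid Braid0 ?eqxx //.
by rewrite cmp0r wh0 cmp0l scaler0.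
Qed.

(** Rotating a monomial of the braid relation breaks its strands of colour [i] into a cup, which
    takes the r left dots, and a cap. *)
Lemma sideways_term i j r w u (f : hom (E j :: u) (E j :: E i :: F i :: w)) :
  wh (F i) (wh (E i) (wh (E j) (Eps i w))
    \ov (Xp i r (E j :: E i :: F i :: w) \ov wh (E i) f))
    \ov Eta i (E j :: u)
  = Etax i r (E j :: w) \ov (wh (E j) (Eps i w) \ov f).
Proof.
rewrite cmpA.
have := Xp_nat (hhom_wh (E j) (hhom_Eps i w)) i r.
rewrite sgn0 scale1r => <-.
by rewrite -cmpA -wh_cmp wh_cmp -cmpA -Eta_nat cmpA.
Qed.

Lemma Eps_Xp j q i w :
  wh (E j) (Eps i w) \ov Xp j q (E i :: F i :: w) = Xp j q w
    \ov wh (E j) (Eps i w).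
Proof. by rewrite (Xp_nat (hhom_Eps i w)) sgn0 scale1r. Qed.

Lemma dn_pos i j p : i != j -> p \in iota 1 (dn i j).-1 ->
  (0 < p)%N /\ p%:Z < dij D i j.
Proof.
move=> nij; rewrite mem_iota add1n => /andP[p0 lp]; split=> //.
have d0 := dij_ge0 D nij; rewrite -(gez0_abs d0) ltz_nat.
by rewrite -[`|_|%N]/(dn i j); move: lp p0; case: (dn i j) => [|d] /=;
  case: p => [|p].
Qed.

Lemma sij_gr i j p q : i != j -> p \in iota 1 (dn i j).-1 ->
  q \in iota 1 (dn j i).-1 ->
  gr false (sij Q i j p q).
Proof.
move=> nij ip iq; have nji : j != i by rewrite eq_sym.
have [[p0 lp] [q0 lq]] := (dn_pos nij ip, dn_pos nji iq).
exact: sij_even.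
Qed.

Lemma sgnM_gr b d : gr false d -> gr false (sgn b * d).
Proof. by move=> gd; rewrite -[false]/(false (+) false); apply: grM => //;
  apply: even_sgn. Qed.

Lemma Sig_braid_iji i j w : par i -> i != j ->
  wh (F i) (Tau j i w) \ov Sig j i (E i :: w) \ov wh (E j) (Sig i i w)
  - Sig i i (E j :: w) \ov wh (E i) (Sig j i w) \ov Tau j i (F i :: w)
  = \sum_(r <- iota 0 (dn i j)) (sgn (odd ((dn i j).-1 - r)%N) * tij Q i j) *:
      (Etax i r (E j :: w) \ov wh (E j) (Epsx i ((dn i j).-1 - r) w))
  + \sum_(p <- iota 1 (dn i j).-1) \sum_(q <- iota 1 (dn j i).-1)
    \sum_(r <- iota 0 p)
     (sgn (odd (p.-1 - r)%N) * sij Q i j p q) *: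
     (Etax i r (E j :: w) \ov (Xp j q w \ov wh (E j) (Epsx i (p.-1 - r) w))).
Proof.
move=> pi nij; rewrite Sig_braid (Braid_iji _ nij) pi /=.
(* For odd [i] the prefactor of [Sig_braid] is the sign of [par j]. It cancels the same factor in
   the braid coefficients, and only the parity of the number of right dots is left. *)
have sE b : sgn (par j) * sgn (par j (+) b)
  = sgn b by rewrite sgnD mulrA sgn_sq mul1r.
rewrite cmpDr whD cmpDl scalerDr; congr (_ + _).
  rewrite cmp_sumr wh_sum cmp_suml scaler_sumr; apply: eq_bigr => r _.
  have ev := sgnM_gr (par j (+) odd ((dn i j).-1 - r)%N) (tij_even Q i j).
  rewrite (cmpZr_even _ _ ev) (whZ _ _ ev) cmpZl scalerA mulrA sE sideways_term.
  by rewrite -wh_cmp.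
rewrite cmp_sumr wh_sum cmp_suml scaler_sumr big_seq [RHS]big_seq;
  apply: eq_bigr => p ip.
rewrite cmp_sumr wh_sum cmp_suml scaler_sumr big_seq [RHS]big_seq;
  apply: eq_bigr => q iq.
rewrite cmp_sumr wh_sum cmp_suml scaler_sumr; apply: eq_bigr => r _.
have ev := sgnM_gr (par j (+) odd (p.-1 - r)%N) (sij_gr nij ip iq).
rewrite (cmpZr_even _ _ ev) (whZ _ _ ev) cmpZl scalerA mulrA sE sideways_term.
congr (_ *: (_ \ov _)); by rewrite cmpA Eps_Xp -cmpA -wh_cmp.
Qed.

(* In both cases the bubble is the composite with n dots, n = |<h_i, l>|. *)
Definition Zeta i n w : hom w (E i :: F i :: w) :=
  if n is m.+1 then Del i m w else Sinv i i w \ov Eta i w.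
Definition Gama i n w : hom (F i :: E i :: w) w :=
  if n is m.+1 then Gam i m w else Eps i w \ov Sinv i i w.

(** * Entries of the inverse matrix at weights of one sign *)

Section Positive.
Variables (i : I) (n : nat) (w : wd).
Hypotheses (pi : par i) (hE : h i w = Posz n).

Let hp : hpos i (tgt l w) = n. Proof. by have [] := hposP hE. Qed.
Let hn : hneg i (tgt l w) = 0%N. Proof. by have [] := hposP hE. Qed.

Lemma SigK_pos : Sig i i w \ov Sinv i i w = id (F i :: E i :: w).
Proof. by have := M_FE w i; rewrite hn big_ord0 addr0. Qed.

Lemma M_expand u (X : hom u (E i :: F i :: w)) :
  X = Sinv i i w \ov (Sig i i w \ov X) + \sum_(m < n) Del i m w
    \ov (Epsx i m w \ov X).
Proof.
rewrite -{1}(cmp1l X) -M_EF hp cmpDl cmpA cmp_suml; congr (_ + _).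
by apply: eq_bigr => m _; rewrite cmpA.
Qed.

Lemma Sig_Zeta : Sig i i w \ov Zeta i n w = if n is 0%N then Eta i w else 0.
Proof.
move: hp; rewrite /Zeta; case: n => [|m] hp';
  first by rewrite cmpA SigK_pos cmp1l.
by apply: Sig_Del; rewrite hp'.
Qed.

Lemma Epsx_Zeta m : (m < n)%N ->
  Epsx i m w \ov Zeta i n w = if m.+1 == n then id w else 0.
Proof.
move: hp; rewrite /Zeta; case: n => [|a] hp' // lm.
by rewrite Epsx_Del ?hp' // eqSS.
Qed.

Lemma Bub_Zeta : Bub i w = Epsx i n w \ov Zeta i n w.
Proof.
case: n hE => [|m] hE'; last exact: Bub_pos.
by rewrite Bub0 // /Epsx Xp0 cmp1r cmpA.
Qed.

(** The entry with index n - 1 has the parity of n - 1, and for n = 0 the inverse crossing is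
    odd. *)
Lemma hhom_Zeta : hhom (~~ odd n) (Zeta i n w).
Proof.
rewrite /Zeta; case: n => [|m] /=.
  by have := hhom_cmp (hhom_Sinv i i w) (hhom_Eta i w); rewrite pi.
by have := hhom_Del i m w; rewrite pi andbT negbK.
Qed.

(** By [M_expand] a morphism into E_i F_i is determined by its composites with the entries of M; the
    prescribed ones are those of [Zeta] composed with [Y]. *)
Lemma Zeta_uniq u (X : hom u (E i :: F i :: w)) (Y : hom u w) :
  Sig i i w \ov X = (if n is 0%N then Eta i w \ov Y else 0) ->
  (forall m, (m < n)%N -> Epsx i m w \ov X = if m.+1 == n then Y else 0) ->
  X = Zeta i n w \ov Y.
Proof.
move=> eS eE; rewrite [LHS]M_expand eS.
under eq_bigr do rewrite eE //.
rewrite /Zeta; case: n {eS eE} => [|m]; first by rewrite big_ord0 addr0 cmpA.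
rewrite cmp0r add0r big_ord_recr /= eqxx big1 ?add0r // => a _.
by rewrite eqSS ltn_eqF ?cmp0r.
Qed.

End Positive.

Section Negative.
Variables (i : I) (n : nat) (w : wd).
Hypotheses (pi : par i) (hE : h i w = - Posz n).

Let hp : hpos i (tgt l w) = 0%N. Proof. by have [] := hnegP hE. Qed.
Let hn : hneg i (tgt l w) = n. Proof. by have [] := hnegP hE. Qed.

Lemma SinvK_neg : Sinv i i w \ov Sig i i w = id (E i :: F i :: w).
Proof. by have := M_EF w i; rewrite hp big_ord0 addr0. Qed.

Lemma M_expand_neg u (X : hom (F i :: E i :: w) u) :
  X = X \ov Sig i i w \ov Sinv i i w + \sum_(m < n) X \ov Etax i m w
    \ov Gam i m w.
Proof.
rewrite -{1}(cmp1r X) -M_FE hn cmpDr cmpA cmp_sumr; congr (_ + _).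
by apply: eq_bigr => m _; rewrite cmpA.
Qed.

Lemma Gama_Sig : Gama i n w \ov Sig i i w = if n is 0%N then Eps i w else 0.
Proof.
move: hn; rewrite /Gama; case: n => [|m] hn';
  first by rewrite -cmpA SinvK_neg cmp1r.
by apply: Gam_Sig; rewrite hn'.
Qed.

Lemma Gama_Etax m : (m < n)%N ->
  Gama i n w \ov Etax i m w = if m.+1 == n then id w else 0.
Proof.
move: hn; rewrite /Gama; case: n => [|a] hn' // lm.
by rewrite Gam_Etax ?hn' // eqSS eq_sym.
Qed.

Lemma Bub_Gama : Bub i w = Gama i n w \ov Etax i n w.
Proof.
case: n hE => [|m] hE'; last exact: Bub_neg.
by rewrite Bub0 // /Etax Xp0 wh_id cmp1l.
Qed.

End Negative.

Lemma Gama_nat i n w w' p (f : hom w w') : par i -> hhom p f ->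
  Gama i n w' \ov wh (F i) (wh (E i) f) = sgn (p && ~~ odd n) *: (f
    \ov Gama i n w).
Proof.
move=> pi hf; rewrite /Gama; case: n => [|m] /=; last first.
  by rewrite (Gam_nat hf) pi andbT negbK.
rewrite -cmpA (Sinv_nat hf) pi cmpZr_sgn !cmpA; congr (_ *: _).
by rewrite Eps_nat.
Qed.

(** [Phi] carries the strand [j] from the left of the cup-like [z] to its right; [Psi] does the same
    underneath the cap-like [g]. *)
Definition Phi i j w (z : hom w (E i :: F i :: w)) : hom (E j :: w)
  (E i :: F i :: E j :: w) :=
  wh (E i) (Sig j i w) \ov Tau j i (F i :: w) \ov wh (E j) z.
Definition Psi i j w (g : hom (F i :: E i :: E j :: w) (E j :: w)) :
    hom (E j :: F i :: E i :: w) (E j :: w) :=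
  g \ov wh (F i) (Tau j i w) \ov Sig j i (E i :: w).

(** By [Zeta_uniq] the equations for [Sig] and for fewer than n' dots make [Phi] equal to t times
    [Zeta] over [E j :: w]. The equation with n' dots then becomes the slide, since t cancels. *)
Lemma slide_of_Phi i j w n n' (t : k) : par i -> gr false t ->
  t \is a GRing.unit ->
  h i w = Posz n -> h i (E j :: w) = Posz n' ->
  Sig i i (E j :: w) \ov Phi j (Zeta i n w)
    = (if n' is 0%N then t *: Eta i (E j :: w) else 0) ->
  (forall m, (m < n')%N -> Epsx i m (E j :: w) \ov Phi j (Zeta i n w)
     = if m.+1 == n' then t *: id (E j :: w) else 0) ->
  Epsx i n' (E j :: w) \ov Phi j (Zeta i n w) = t *: wh (E j) (Bub i w) ->
  Bub i (E j :: w) = wh (E j) (Bub i w).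
Proof.
move=> pi tev tu hE hE' eS eE eB.
have e : Phi j (Zeta i n w) = t *: Zeta i n' (E j :: w).
  rewrite -[RHS]cmp1r cmpZl -(cmpZr_even _ _ tev); apply: (Zeta_uniq hE') => //.
  by rewrite eS (cmpZr_even _ _ tev) cmp1r.
apply: (scale_unit_inj tu).
by rewrite -eB e (cmpZr_even _ _ tev) (Bub_Zeta pi hE').
Qed.

Lemma slide_of_Psi i j w n n' (t : k) : par i -> gr false t ->
  t \is a GRing.unit ->
  h i w = - Posz n -> h i (E j :: w) = - Posz n' ->
  Psi (Gama i n' (E j :: w)) \ov wh (E j) (Sig i i w)
    = (if n is 0%N then t *: wh (E j) (Eps i w) else 0) ->
  (forall m, (m < n)%N -> Psi (Gama i n' (E j :: w)) \ov wh (E j) (Etax i m w)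
     = if m.+1 == n then t *: id (E j :: w) else 0) ->
  Psi (Gama i n' (E j :: w)) \ov wh (E j) (Etax i n w) = t *: Bub i (E j :: w)
    ->
  Bub i (E j :: w) = wh (E j) (Bub i w).
Proof.
move=> pi tev tu hE hE' eS eE eB.
have e : Psi (Gama i n' (E j :: w)) = t *: wh (E j) (Gama i n w).
  (* The source of [Psi] has E_j on the left, so the identity of F_i E_i over [w] is expanded first
     and then whiskered by E_j. *)
  have := congr1 (fun X => wh (E j) X) (M_expand_neg hE (id _)); cbv beta.
  rewrite wh_id whD wh_sum => /(congr1 (cmp (Psi (Gama i n' (E j :: w))))).
  rewrite cmp1r => ->; rewrite !cmp1l cmpDr wh_cmp cmpA eS cmp_sumr.
  under eq_bigr do rewrite cmp1l wh_cmp cmpA eE //.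
  rewrite /Gama; case: n {eS eE eB hE} => [|m].
    by rewrite big_ord0 addr0 cmpZl wh_cmp.
  rewrite cmp0l add0r big_ord_recr /= eqxx big1 ?add0r ?cmpZl ?cmp1l // => a _.
  by rewrite eqSS ltn_eqF ?cmp0l.
apply: (scale_unit_inj tu).
by rewrite -eB e cmpZl -wh_cmp (Bub_Gama pi hE).
Qed.

(** The dots pass the rotated crossing with a sign, and the pitchfork relation leaves them between
    two upward crossings, where the quadratic or nilHecke relations apply. *)
Lemma Epsx_Phi i j w n (z : hom w (E i :: F i :: w)) : par i ->
  Epsx i n (E j :: w) \ov Phi j z =
  sgn (par j && odd n) *: (wh (E j) (Eps i w) \ov
    (Tau i j (F i :: w) \ov Xp i n (E j :: F i :: w)
      \ov Tau j i (F i :: w)) \ov wh (E j) z).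
Proof.
move=> pi; rewrite /Epsx /Phi !cmpA -[_ \ov _ \ov wh (E i) _]cmpA.
rewrite (Xp_nat (hhom_Sig j i w)) pi andbT cmpZr_sgn !cmpZl; congr (_ *: _).
by rewrite !cmpA Eps_Sig.
Qed.

Lemma Psi_Etax i j w n (g : hom (F i :: E i :: E j :: w) (E j :: w)) : par i ->
  Psi g \ov wh (E j) (Etax i n w) =
  sgn (par j && odd n) *: (g \ov
    wh (F i) (Tau j i w \ov wh (E j) (Xp i n w) \ov Tau i j w)
      \ov Eta i (E j :: w)).
Proof.
move=> pi; rewrite /Etax /Psi wh_cmp !cmpA -[g \ov _ \ov _ \ov _]cmpA.
rewrite (Sig_nat (hhom_Xp i n w)) pi andbT [odd n && _]andbC cmpZr_sgn !cmpZl;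
  congr (_ *: _).
rewrite !cmpA -[LHS]cmpA Sig_Eta !cmpA; congr (_ \ov _).
by rewrite -!cmpA -!wh_cmp.
Qed.

Lemma Tau_Xp i j w n : i != j ->
  Tau i j w \ov Xp i n (E j :: w)
  = sgn (par i && par j && odd n) *: (wh (E j) (Xp i n w) \ov Tau i j w).
Proof.
move=> nij; elim: n => [|n IH];
  first by rewrite !Xp0 wh_id cmp1l cmp1r andbF scale1r.
rewrite !XpS cmpA TauDotl // cmpZl -[X in _ *: X]cmpA IH cmpZr_sgn scalerA
  wh_cmp !cmpA.
by congr (_ *: _); rewrite -sgnD /=; case: (par i) (par j) (odd n) => [] [] [].
Qed.

Lemma Xp_Tau i j w n : i != j ->
  Xp i n (E j :: w) \ov Tau j i w
  = sgn (par i && par j && odd n) *: (Tau j i w \ov wh (E j) (Xp i n w)).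
Proof.
rewrite eq_sym => nij; elim: n => [|n IH];
  first by rewrite !Xp0 wh_id cmp1l cmp1r andbF scale1r.
rewrite !XpS -cmpA IH cmpZr_sgn cmpA TauDotr // cmpZl scalerA wh_cmp !cmpA.
by congr (_ *: _); rewrite -sgnD /=; case: (par i) (par j) (odd n) => [] [] [].
Qed.

(** * The slide for distinct colours *)

Lemma dn_eq0 i j : (dn i j == 0%N) = (dij D i j == 0).
Proof. exact: absz_eq0. Qed.

Lemma dn_even i j : par i -> ~~ odd (dn i j).
Proof. exact: dij_even. Qed.

Lemma sij_odd0 i j p q : par i -> i != j -> p \in iota 1 (dn i j).-1 ->
  q \in iota 1 (dn j i).-1 -> odd p -> sij Q i j p q = 0.
Proof.
move=> pi nij ip iq op; have nji : j != i by rewrite eq_sym.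
have [[p0 lp] [q0 lq]] := (dn_pos nij ip, dn_pos nji iq).
by apply: sij_odd => //; rewrite op.
Qed.

Lemma sij_swap i j p q : i != j -> p \in iota 1 (dn i j).-1 ->
  q \in iota 1 (dn j i).-1 -> sij Q i j p q = sij Q j i q p.
Proof.
move=> nij ip iq; have nji : j != i by rewrite eq_sym.
have [[p0 lp] [q0 lq]] := (dn_pos nij ip, dn_pos nji iq).
exact: sij_sym.
Qed.

Lemma Epsx_add i m n w : Epsx i m w \ov Xp i n (F i :: w) = Epsx i (m + n) w.
Proof. by rewrite /Epsx XpD cmpA. Qed.

Lemma Epsx0 i w : Epsx i 0 w = Eps i w.
Proof. by rewrite /Epsx Xp0 cmp1r. Qed.

Lemma Etax0 i w : Etax i 0 w = Eta i w.
Proof. by rewrite /Etax Xp0 wh_id cmp1l. Qed.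

Lemma hhom_Epsx i n w : hhom (odd n && par i) (Epsx i n w).
Proof. by rewrite -[_ && _]addFb; apply: hhom_cmp;
  [apply: hhom_Eps | apply: hhom_Xp]. Qed.

Lemma whEpsx_Xp i j n q w :
  wh (E j) (Epsx i n w) \ov Xp j q (E i :: F i :: w)
  = sgn ((odd n && par i) && (odd q && par j)) *: (Xp j q w
    \ov wh (E j) (Epsx i n w)).
Proof. by rewrite (Xp_nat (hhom_Epsx i n w)) scalerA sgn_sq scale1r. Qed.

(** In the quadratic relation the coefficients with odd p vanish, and even p < [dn i j], including p
    = 0, is killed by [z]. Only the pure power of x_i survives. *)
Lemma Epsx_Phi_neq i j w n (z : hom w (E i :: F i :: w)) : par i -> i != j ->
  (forall p, ~~ odd p -> (p < dn i j)%N -> Epsx i (n + p) w \ov z = 0) ->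
  Epsx i n (E j :: w) \ov Phi j z
  = tij Q i j *: wh (E j) (Epsx i (n + dn i j) w \ov z).
Proof.
move=> pi nij z0; have nji : j != i by rewrite eq_sym.
rewrite Epsx_Phi // Tau_Xp // cmpZl cmpZr_sgn cmpZl scalerA pi sgn_sq scale1r.
rewrite -[X in _ \ov X \ov _]cmpA cmpA -wh_cmp -/(Epsx i n w).
have [/eqP d0|d0] := boolP (dn i j == 0%N).
  have dij0 : dij D i j = 0 by apply/eqP; rewrite -dn_eq0 d0.
  have dji0 : dij D j i = 0 by apply/dij_eq0.
  rewrite d0 addn0 TauK0 // -(tij_sym Q dij0) (cmpZr_even _ _ (tij_even Q i j)).
  by rewrite cmpZl cmp1r -wh_cmp.
have d0' : dij D j i != 0.
  by apply: contra d0 => /eqP e; rewrite dn_eq0; apply/eqP/dij_eq0.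
have term p q : ~~ odd p -> (p < dn i j)%N ->
    wh (E j) (Epsx i n w) \ov (Xp j q (E i :: F i :: w)
      \ov wh (E j) (Xp i p (F i :: w)))
      \ov wh (E j) z = 0.
  move=> ep lp; rewrite cmpA whEpsx_Xp !cmpZl -2!cmpA -wh_cmp -wh_cmp cmpA
    Epsx_add z0 //.
  by rewrite wh0 cmp0r scaler0.
have d_gt0 : (0 < dn i j)%N by rewrite lt0n.
rewrite TauK // !cmpDr !cmpDl (cmpZr_even _ _ (tij_even Q j i)) cmpZl.
(* The pure power of x_j is the case p = 0 of [term]. *)
have := term 0%N (dn j i) isT d_gt0; rewrite Xp0 wh_id cmp1r => ->.
rewrite scaler0 add0r (cmpZr_even _ _ (tij_even Q i j)) cmpZl -!wh_cmp Epsx_add.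
rewrite cmp_sumr cmp_suml big_seq big1 ?addr0 // => q iq.
rewrite cmp_sumr cmp_suml big_seq big1 // => p ip.
have [op|ep] := boolP (odd p).
  by rewrite (sij_swap nji iq ip) (sij_odd0 pi nij ip iq op)
    scale0r cmp0r cmp0l.
rewrite (cmpZr_even _ _ (sij_gr nji iq ip)) cmpZl term ?scaler0 //.
by have [_] := dn_pos nij ip; rewrite -(gez0_abs (dij_ge0 D nij)).
Qed.

(** The same cancellation on cups: dots on the strand [j] slide out past the cup, and the lower even
    powers of x_i die against [g]. *)
Lemma Psi_Etax_neq i j w n (g : hom (F i :: E i :: E j :: w) (E j :: w)) :
  par i -> i != j ->
  (forall p, ~~ odd p -> (p < dn i j)%N ->
    g \ov Etax i (n + p) (E j :: w) = 0) ->
  Psi g \ov wh (E j) (Etax i n w)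
  = tij Q i j *: (g \ov Etax i (n + dn i j) (E j :: w)).
Proof.
move=> pi nij g0; have nji : j != i by rewrite eq_sym.
rewrite Psi_Etax //.
have -> : Tau j i w \ov wh (E j) (Xp i n w)
    = sgn (par j && odd n) *: (Xp i n (E j :: w) \ov Tau j i w).
  by rewrite Xp_Tau // pi scalerA sgn_sq scale1r.
rewrite cmpZl wh_sgn cmpZr_sgn cmpZl scalerA sgn_sq scale1r -cmpA -cmpA.
have term p q : g \ov (wh (F i) (Xp i n (E j :: w) \ov
      (Xp i p (E j :: w) \ov wh (E i) (Xp j q w))) \ov Eta i (E j :: w))
    = g \ov Etax i (n + p) (E j :: w) \ov Xp j q w.
  rewrite [X in wh _ X]cmpA -XpD wh_cmp -[X in g \ov X]cmpA -Eta_nat.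
  by rewrite /Etax !cmpA.
have [/eqP d0|d0] := boolP (dn i j == 0%N).
  have dij0 : dij D i j = 0 by apply/eqP; rewrite -dn_eq0 d0.
  rewrite TauK0 // d0 addn0 (cmpZr_even _ _ (tij_even Q i j)).
  by rewrite (whZ _ _ (tij_even Q i j)) cmpZl (cmpZr_even _ _ (tij_even Q i j))
    cmp1r.
have d0' : dij D i j != 0 by rewrite -dn_eq0.
have d_gt0 : (0 < dn i j)%N by rewrite lt0n.
rewrite TauK // !cmpDr !whD !cmpDl !cmpDr.
rewrite (cmpZr_even _ _ (tij_even Q j i)) (whZ _ _ (tij_even Q j i)) cmpZl.
rewrite (cmpZr_even _ _ (tij_even Q j i)).
have := term 0%N (dn j i); rewrite Xp0 cmp1l => ->.
rewrite g0 // cmp0l scaler0 addr0.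
rewrite (cmpZr_even _ _ (tij_even Q i j)) (whZ _ _ (tij_even Q i j)) cmpZl.
rewrite (cmpZr_even _ _ (tij_even Q i j)).
have := term (dn i j) 0%N; rewrite Xp0 wh_id !cmp1r => ->.
rewrite cmp_sumr wh_sum cmp_suml cmp_sumr big_seq big1 ?addr0 // => p ip.
rewrite cmp_sumr wh_sum cmp_suml cmp_sumr big_seq big1 // => q iq.
have [op|ep] := boolP (odd p).
  by rewrite (sij_odd0 pi nij ip iq op) scale0r cmp0r wh0 cmp0l cmp0r.
have ev := sij_gr nij ip iq.
rewrite (cmpZr_even _ _ ev) (whZ _ _ ev) cmpZl (cmpZr_even _ _ ev)
  term g0 ?cmp0l ?scaler0 //.
by have [_] := dn_pos nij ip; rewrite -(gez0_abs (dij_ge0 D nij)).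
Qed.

Section Cases.
Variables (i j : I) (w : wd).
Hypotheses (pi : par i) (nij : i != j).

Let d := dn i j.
Let tev := tij_even Q i j.

(** The rotated braid relation moves [Sig] next to [z], where [Sig_Zeta] can evaluate it; the
    correction terms see [z] only through dotted caps. *)
Lemma Sig_Phi (z : hom w (E i :: F i :: w)) :
  Sig i i (E j :: w) \ov Phi j z =
  wh (F i) (Tau j i w) \ov Sig j i (E i :: w) \ov wh (E j) (Sig i i w \ov z)
  - (\sum_(r <- iota 0 d) (sgn (odd (d.-1 - r)%N) * tij Q i j) *:
      (Etax i r (E j :: w) \ov wh (E j) (Epsx i (d.-1 - r) w \ov z))
  + \sum_(p <- iota 1 d.-1) \sum_(q <- iota 1 (dn j i).-1) \sum_(r <- iota 0 p)
     (sgn (odd (p.-1 - r)%N) * sij Q i j p q) *: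
     (Etax i r (E j :: w) \ov (Xp j q w
       \ov wh (E j) (Epsx i (p.-1 - r) w \ov z)))).
Proof.
have e := Sig_braid_iji w pi nij.
have -> : Sig i i (E j :: w) \ov Phi j z
  = Sig i i (E j :: w) \ov wh (E i) (Sig j i w) \ov Tau j i (F i :: w)
    \ov wh (E j) z.
  by rewrite /Phi !cmpA.
have {e}-> : Sig i i (E j :: w) \ov wh (E i) (Sig j i w) \ov Tau j i (F i :: w)
  = wh (F i) (Tau j i w) \ov Sig j i (E i :: w) \ov wh (E j) (Sig i i w)
    - (wh (F i) (Tau j i w) \ov Sig j i (E i :: w) \ov wh (E j) (Sig i i w)
    - Sig i i (E j :: w) \ov wh (E i) (Sig j i w) \ov Tau j i (F i :: w)).
  by rewrite subKr.
rewrite (Sig_braid_iji w pi nij) cmpBl cmpDl !cmp_suml; congr (_ - (_ + _)).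
- by rewrite wh_cmp cmpA.
- by apply: eq_bigr => r _; rewrite cmpZl -cmpA -wh_cmp.
apply: eq_bigr => p _; rewrite cmp_suml; apply: eq_bigr => q _.
rewrite cmp_suml; apply: eq_bigr => r _; rewrite cmpZl; congr (_ *: _).
by rewrite -[LHS]cmpA -[X in _ \ov X = _]cmpA -wh_cmp.
Qed.

Lemma Psi_Sig (g : hom (F i :: E i :: E j :: w) (E j :: w)) :
  Psi g \ov wh (E j) (Sig i i w) =
  g \ov Sig i i (E j :: w) \ov wh (E i) (Sig j i w) \ov Tau j i (F i :: w)
  + (\sum_(r <- iota 0 d) (sgn (odd (d.-1 - r)%N) * tij Q i j) *:
      (g \ov Etax i r (E j :: w) \ov wh (E j) (Epsx i (d.-1 - r) w))
  + \sum_(p <- iota 1 d.-1) \sum_(q <- iota 1 (dn j i).-1) \sum_(r <- iota 0 p)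
     (sgn (odd (p.-1 - r)%N) * sij Q i j p q) *:
     (g \ov Etax i r (E j :: w) \ov (Xp j q w
       \ov wh (E j) (Epsx i (p.-1 - r) w)))).
Proof.
have -> : Psi g \ov wh (E j) (Sig i i w)
  = g \ov (wh (F i) (Tau j i w) \ov Sig j i (E i :: w)
    \ov wh (E j) (Sig i i w)).
  by rewrite /Psi !cmpA.
have -> : wh (F i) (Tau j i w) \ov Sig j i (E i :: w) \ov wh (E j) (Sig i i w)
  = Sig i i (E j :: w) \ov wh (E i) (Sig j i w) \ov Tau j i (F i :: w)
    + (wh (F i) (Tau j i w) \ov Sig j i (E i :: w) \ov wh (E j) (Sig i i w)
    - Sig i i (E j :: w) \ov wh (E i) (Sig j i w) \ov Tau j i (F i :: w)).
  by rewrite addrC subrK.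
rewrite (Sig_braid_iji w pi nij) cmpDr; congr (_ + _); first by rewrite !cmpA.
rewrite cmpDr !cmp_sumr; congr (_ + _).
  by apply: eq_bigr => r _; rewrite (cmpZr_even _ _ (sgnM_gr _ tev)) cmpA.
rewrite big_seq [RHS]big_seq; apply: eq_bigr => p ip; rewrite cmp_sumr.
rewrite big_seq [RHS]big_seq; apply: eq_bigr => q iq; rewrite cmp_sumr.
by apply: eq_bigr => r _; rewrite (cmpZr_even _ _ (sgnM_gr _ (sij_gr nij ip
  iq))) cmpA.
Qed.

Lemma slide_neq_pos n n' : h i w = Posz n -> h i (E j :: w) = Posz n' ->
  n = (n' + d)%N -> Bub i (E j :: w) = wh (E j) (Bub i w).
Proof.
move=> hE hE' en; have ed : ~~ odd d := dn_even j pi.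
have small m : (m.+1 < n)%N -> Epsx i m w \ov Zeta i n w = 0.
  by move=> lm; rewrite (Epsx_Zeta hE (ltnW lm)) ltn_eqF.
apply: (slide_of_Phi pi tev (tij_unit Q i j) hE hE') => [|m lm|].
- rewrite Sig_Phi (Sig_Zeta hE).
  (* Since p < d, the exponent p - 1 - r is below n - 1 and [small] kills every term with a
     coefficient [sij]. *)
  rewrite [X in _ - (_ + X)]big_seq [X in _ - (_ + X)]big1 ?addr0; last first.
    move=> p; rewrite mem_iota => /andP[p0 lp].
    rewrite big1 // => q _; rewrite big_seq big1 // => r;
      rewrite mem_iota add0n => lr.
    rewrite small ?wh0 ?cmp0r ?scaler0 //; lia.
  have [n0|n_gt0] := posnP n.
    have [n'0 d0] : n' = 0%N /\ d = 0%N by lia.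
    rewrite n0 n'0 d0 big_nil subr0 -[LHS]cmpA Sig_Eta cmpA -wh_cmp.
    have dij0 : dij D i j = 0 by apply/eqP; rewrite -dn_eq0 -/d d0.
    by rewrite TauK0 // (whZ _ _ tev) cmpZl wh_id cmp1l.
  rewrite (_ : (if n is 0%N then _ else _) = 0); last by case: (n) n_gt0.
  (* If n' > 0, every exponent is below the critical n - 1; if n' = 0, that is n = d, only r = 0
     reaches it. *)
  rewrite wh0 cmp0r sub0r; case: n' en {hE'} => [|n'] en; last first.
    rewrite big_seq big1 ?oppr0 // => r; rewrite mem_iota add0n => lr.
    by rewrite small ?wh0 ?cmp0r ?scaler0 //; lia.
  case: d en ed small => [|d'] en ed small; first by move: n_gt0; rewrite en.
  rewrite [iota 0 _]/= big_cons /= subn0 big_seq big1 ?addr0; last first.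
    move=> r; rewrite mem_iota => lr; rewrite small ?wh0 ?cmp0r ?scaler0 //;
      lia.
  rewrite (Epsx_Zeta hE) ?en // eqxx wh_id cmp1r Etax0.
  (* As d is even, d - 1 is odd, and its sign cancels the minus from [Sig_Phi]. *)
  by move: ed; rewrite /= negbK => ->; rewrite sgn1 mulN1r scaleNr opprK.
- rewrite Epsx_Phi_neq //; last by move=> p _ lp; apply: small;
  rewrite -/d in lp *; lia.
  rewrite (Epsx_Zeta hE) -/d; last by lia.
  rewrite (_ : ((m + d).+1 == n) = (m.+1 == n')); last by lia.
  by case: eqP; rewrite ?wh_id // wh0 scaler0.
rewrite Epsx_Phi_neq //; first by rewrite -/d -en (Bub_Zeta pi hE).
by move=> p ep lp; apply: small; rewrite -/d in lp *; lia.
Qed.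

Lemma slide_neq_neg n n' : h i w = - Posz n -> h i (E j :: w) = - Posz n' ->
  n' = (n + d)%N -> Bub i (E j :: w) = wh (E j) (Bub i w).
Proof.
move=> hE hE' en; have ed : ~~ odd d := dn_even j pi.
have small m : (m.+1 < n')%N -> Gama i n' (E j :: w)
  \ov Etax i m (E j :: w) = 0.
  by move=> lm; rewrite (Gama_Etax hE' (ltnW lm)) ltn_eqF.
apply: (slide_of_Psi pi tev (tij_unit Q i j) hE hE') => [|m lm|].
- rewrite Psi_Sig (Gama_Sig hE').
  rewrite [X in _ + (_ + X)]big_seq [X in _ + (_ + X)]big1 ?addr0; last first.
    move=> p; rewrite mem_iota => /andP[p0 lp].
    rewrite big1 // => q _; rewrite big_seq big1 // => r;
      rewrite mem_iota add0n => lr.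
    rewrite small ?cmp0l ?scaler0 //; lia.
  have [n0|n_gt0] := posnP n'.
    have [n'0 d0] : n = 0%N /\ d = 0%N by lia.
    rewrite n0 n'0 d0 big_nil addr0 Eps_Sig -cmpA.
    have dij0 : dij D i j = 0 by apply/eqP; rewrite -dn_eq0 -/d d0.
    have dji0 : dij D j i = 0 by apply/dij_eq0.
    by rewrite TauK0 // -(tij_sym Q dij0) (cmpZr_even _ _ tev) cmp1r.
  rewrite (_ : (if n' is 0%N then _ else _) = 0); last by case: (n') n_gt0.
  rewrite !cmp0l add0r; case: n en {hE} => [|n] en; last first.
    rewrite big_seq big1 // => r; rewrite mem_iota add0n => lr.
    by rewrite small ?cmp0l ?scaler0 //; lia.
  (* With n = 0 and n' = d only the last term r = d - 1 survives, and it has no dot on the cap,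
     hence no sign. *)
  have dE : d = d.-1.+1 by lia.
  rewrite [in iota _ _]dE -[in iota _ _]addn1 iotaD big_cat big_seq1 add0n /=.
  rewrite big_seq big1 ?add0r; last first.
    move=> r; rewrite mem_iota => lr; rewrite small ?cmp0l ?scaler0 //; lia.
  rewrite (Gama_Etax hE'); last by lia.
  rewrite (_ : _ == _); last by lia.
  by rewrite cmp1l subnn Epsx0 sgn0 mul1r.
- rewrite Psi_Etax_neq //; last by move=> p _ lp; apply: small;
  rewrite -/d in lp *; lia.
  rewrite (Gama_Etax hE') -/d; last by lia.
  rewrite (_ : ((m + d).+1 == n') = (m.+1 == n)); last by lia.
  by case: eqP; rewrite ?scaler0.
rewrite Psi_Etax_neq //; first by rewrite -/d -en (Bub_Gama pi hE').
by move=> p ep lp; apply: small; rewrite -/d in lp *; lia.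
Qed.

(* The terms r = n' and r = n'.+1 of the rotated braid relation survive; they
   are the two bubbles, with opposite signs. *)
Lemma slide_neq_cross n n' : h i w = Posz n.+1 ->
  h i (E j :: w) = - Posz n'.+1 ->
  d = (n + n').+2 -> Bub i (E j :: w) = wh (E j) (Bub i w).
Proof.
move=> hE hE' en; have ed : ~~ odd d := dn_even j pi.
set z := Zeta i n.+1 w; set g := Gama i n'.+1 (E j :: w).
have smallz m : (m < n)%N -> Epsx i m w \ov z = 0.
  by move=> lm; rewrite (Epsx_Zeta hE) ?eqSS ?ltn_eqF // ltnW.
have smallg m : (m < n')%N -> g \ov Etax i m (E j :: w) = 0.
  by move=> lm; rewrite (Gama_Etax hE') ?eqSS ?ltn_eqF // ltnW.
(* [g] kills [Sig] over [E j :: w] and [Sig] over [w] kills [z], so [Sig_Phi] yields a vanishing sum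
   of correction terms. *)
have : g \ov (Sig i i (E j :: w) \ov Phi j z) = 0.
  by rewrite cmpA (Gama_Sig hE') cmp0l.
rewrite Sig_Phi (Sig_Zeta hE) wh0 cmp0r sub0r cmpNr => /eqP;
  rewrite oppr_eq0 => /eqP.
rewrite cmpDr; rewrite [X in _ + g \ov X]big_seq [X in _ + X]cmp_sumr.
rewrite [X in _ + X]big1 ?addr0; last first.
  move=> p ip; rewrite big_seq cmp_sumr big1 // => q iq.
  rewrite big_seq cmp_sumr big1 // => r; rewrite mem_iota add0n => lr.
  have ev := sgnM_gr (odd (p.-1 - r)) (sij_gr nij ip iq).
  have [op|ep] := boolP (odd p).
    by rewrite (sij_odd0 pi nij ip iq op) mulr0 scale0r cmp0r.
  rewrite (cmpZr_even _ _ ev) cmpA.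
  have [ln|ln] := ltnP r n'; first by rewrite smallg ?cmp0l ?scaler0.
  (* Both p and d are even, so p <= d - 2; with r >= n' the exponent p - 1 - r is then below n.
     Without parity it could equal n. *)
  move: ip; rewrite mem_iota -/d => lp.
  rewrite smallz ?wh0 ?cmp0r ?scaler0 //; lia.
have -> : iota 0 d = iota 0 n' ++ [:: n'; n'.+1] ++ iota n'.+2 n.
  by rewrite en (_ : (n + n').+2 = n' + (2 + n))%N ?iotaD ?addn2 //; lia.
have ev b := sgnM_gr b tev.
rewrite !big_cat /= !cmpDr !cmp_sumr big_seq big1 ?add0r; last first.
  move=> r; rewrite mem_iota add0n => lr.
  by rewrite (cmpZr_even _ _ (ev _)) cmpA smallg ?cmp0l ?scaler0.
rewrite [X in _ + X]big_seq [X in _ + X]big1 ?addr0; last first.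
  move=> r; rewrite mem_iota => lr.
  rewrite (cmpZr_even _ _ (ev _)) smallz ?wh0 ?cmp0r ?scaler0 //; lia.
rewrite big_cons big_seq1 !(cmpZr_even _ _ (ev _)).
rewrite [X in _ *: X + _]cmpA [X in _ + _ *: X]cmpA.
rewrite (_ : d.-1 - n' = n.+1)%N; last by lia.
rewrite (_ : d.-1 - n'.+1 = n)%N; last by lia.
rewrite (Gama_Etax hE' (ltnSn n')) (Epsx_Zeta hE (ltnSn n))
  !eqxx wh_id cmp1r cmp1l.
rewrite -(Bub_Zeta pi hE) -(Bub_Gama pi hE') -!scalerA /= sgn_neg scaleNr.
rewrite addrC -!scalerBr.
move/(scale_unit_inj0 (sgn_unit k _)) /(scale_unit_inj0 (tij_unit Q i j))/eqP.
by rewrite subr_eq0 => /eqP.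
Qed.

End Cases.

(** * The slide for equal colours *)

(** Odd nilHecke calculus: each dot moved through the crossing changes the sign and leaves a term
    without crossing. *)
Lemma Tau_Xp_diag i n w : par i ->
  Tau i i w \ov Xp i n (E i :: w) =
  \sum_(s < n) sgn (odd s) *: (wh (E i) (Xp i s w)
    \ov Xp i (n.-1 - s) (E i :: w))
  + sgn (odd n) *: (wh (E i) (Xp i n w) \ov Tau i i w).
Proof.
move=> pi; elim: n => [|n IH].
  by rewrite !Xp0 wh_id cmp1l cmp1r big_ord0 add0r scale1r.
have t : Tau i i w \ov Xd i (E i :: w) = id _ - wh (E i) (Xd i w) \ov Tau i i w.
  by rewrite -(TauDotl_diag w i) pi sgn1 scaleN1r opprK addrK.
rewrite XpS cmpA t cmpBl cmp1l -cmpA IH cmpDr cmp_sumr big_ord_recl /= subn0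
  sgn0 scale1r.
rewrite Xp0 wh_id cmp1l -addrA; congr (_ + _); rewrite opprD -sumrN;
  congr (_ + _).
  apply: eq_bigr => s _; rewrite cmpZr_sgn /bump /= add1n XpS wh_cmp cmpA
    sgn_neg scaleNr.
  by rewrite subnS -subn1 subnAC subn1.
by rewrite cmpZr_sgn XpS wh_cmp cmpA sgn_neg scaleNr.
Qed.

Lemma Xp_Tau_diag i n w : par i ->
  wh (E i) (Xp i n w) \ov Tau i i w =
  \sum_(s < n) sgn (odd s) *: (wh (E i) (Xp i (n.-1 - s) w)
    \ov Xp i s (E i :: w))
  + sgn (odd n) *: (Tau i i w \ov Xp i n (E i :: w)).
Proof.
move=> pi; elim: n => [|n IH].
  by rewrite !Xp0 wh_id cmp1l cmp1r big_ord0 add0r scale1r.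
have t : wh (E i) (Xd i w) \ov Tau i i w = id _ - Tau i i w \ov Xd i (E i :: w).
  by rewrite -(TauDotl_diag w i) pi sgn1 scaleN1r opprK addrAC subrr add0r.
rewrite XpSr wh_cmp -cmpA t cmpBr cmp1r cmpA IH cmpDl cmp_suml big_ord_recl /=
  subn0 sgn0 scale1r.
rewrite Xp0 cmp1r -addrA; congr (_ + _); rewrite opprD -sumrN; congr (_ + _).
  apply: eq_bigr => s _; rewrite cmpZl /bump /= add1n XpSr cmpA sgn_neg scaleNr.
  by rewrite subnS -subn1 subnAC subn1.
by rewrite cmpZl XpSr cmpA sgn_neg scaleNr.
Qed.

Lemma Tau_Xp_Tau i n w : par i ->
  Tau i i w \ov Xp i n (E i :: w) \ov Tau i i w =
  \sum_(s < n) sgn (odd s) *: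
     (wh (E i) (Xp i s w) \ov Xp i (n.-1 - s) (E i :: w) \ov Tau i i w).
Proof.
move=> pi; rewrite Tau_Xp_diag // cmpDl cmpZl -[X in _ *: X]cmpA TauK_diag cmp0r
  scaler0 addr0.
by rewrite cmp_suml; apply: eq_bigr => s _; rewrite cmpZl.
Qed.

Lemma Tau_whXp_Tau i n w : par i ->
  Tau i i w \ov wh (E i) (Xp i n w) \ov Tau i i w =
  \sum_(s < n) sgn (odd s) *:
     (Tau i i w \ov wh (E i) (Xp i (n.-1 - s) w) \ov Xp i s (E i :: w)).
Proof.
move=> pi; rewrite -cmpA Xp_Tau_diag // cmpDr cmpZr_sgn cmpA TauK_diag cmp0l
  scaler0 addr0.
by rewrite cmp_sumr; apply: eq_bigr => s _; rewrite cmpZr_sgn cmpA.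
Qed.

Section SignSum.
Variables (V : lmodType k) (n : nat) (f : nat -> nat -> V).
Hypothesis f0 : forall r s, (s < n)%N -> f r s = 0.
(** The signed sum left by m dots between two crossings of colour [i], with s dots on the curl. As
    [f] vanishes for s < n, only the last one or two terms matter below. *)
Let T m := \sum_(s < m) (sgn (odd m) * sgn (odd s)
  * sgn (odd s && odd (m.-1 - s))) *: f (m.-1 - s)%N s.

Lemma sign_sum_small m : (m <= n)%N -> T m = 0.
Proof. by move=> le; apply: big1 => s _;
  rewrite f0 ?scaler0 // (leq_trans _ le). Qed.

Lemma sign_sum1 : T n.+1 = - f 0 n.
Proof.
rewrite /T big_ord_recr big1 => [|s _] /=; last by rewrite f0 ?scaler0 //=.
by rewrite add0r subnn andbF sgn0 mulr1 sgn_neg mulNr sgn_sq scaleN1r.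
Qed.

Lemma sign_sum2 : T n.+2 = sgn (odd n) *: f 1 n - f 0 n.+1.
Proof.
rewrite /T !big_ord_recr big1 => [|s _] /=; last by rewrite f0 ?scaler0 //=.
rewrite add0r subnn subSnn /= andbF andbT sgn0 mulr1 negbK sgn_neg mulrN sgn_sq.
by rewrite mul1r scaleN1r.
Qed.
End SignSum.

Section NonNegative.
Variables (i : I) (n : nat) (w : wd).
Hypotheses (pi : par i) (hE : h i w = Posz n).
Let z := Zeta i n w.
(* A curl with m dots; it vanishes below the critical number n of dots. *)
Let K m := wh (E i) (Epsx i m w) \ov Tau i i (F i :: w) \ov wh (E i) z.

Lemma curl0 : K 0 = if n is 0%N then id (E i :: w) else 0.
Proof.
rewrite /K Epsx0 -Eps_Sig -cmpA -wh_cmp (Sig_Zeta hE).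
by case: (n) => [|m]; [apply: zigzagE | rewrite wh0 cmp0r].
Qed.

(** One dot is pulled through the crossing. The sign combines the minus of the nilHecke relation
    with that of passing [z], whose parity is opposite to n. *)
Lemma curlS m : K m.+1 = wh (E i) (Epsx i m w
  \ov z) + sgn (odd n) *: (K m \ov Xd i w).
Proof.
have t : wh (E i) (Xd i (F i :: w)) \ov Tau i i (F i :: w)
    = id _ - Tau i i (F i :: w) \ov Xd i (E i :: F i :: w).
  by rewrite -(TauDotl_diag (F i :: w) i)
    pi sgn1 scaleN1r opprK addrAC subrr add0r.
rewrite /K {1}/Epsx XpSr cmpA wh_cmp -[X in X \ov _ = _]cmpA t.
rewrite cmpBr cmp1r cmpBl -wh_cmp; congr (_ + _).
rewrite [X in - (X \ov _)]cmpA -[X in - X]cmpA (Dot_nat (hhom_Zeta n w pi)).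
by rewrite pi andbT cmpZr_sgn cmpA sgn_neg scaleNr opprK.
Qed.

Lemma curl_small m : (m < n)%N -> K m = 0.
Proof.
elim: m => [|m IH] lm; first by rewrite curl0; case: (n) lm.
by rewrite curlS (Epsx_Zeta hE (ltnW lm))
  ltn_eqF // wh0 add0r IH ?cmp0l ?scaler0 // ltnW.
Qed.

Lemma curl_top : K n = id (E i :: w).
Proof.
have [n0|] := posnP n; first by rewrite n0 curl0 n0.
case nE : n => [|m] // _; have lm : (m < n)%N by rewrite nE.
rewrite -nE [in LHS]nE curlS (Epsx_Zeta hE lm) nE eqxx wh_id.
by rewrite curl_small ?cmp0l ?scaler0 ?addr0.
Qed.

Lemma curl_next : K n.+1 = wh (E i) (Bub i w) + sgn (odd n) *: Xd i w.
Proof. by rewrite curlS curl_top cmp1l (Bub_Zeta pi hE). Qed.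

Lemma Epsx_Phi_diag m : Epsx i m (E i :: w) \ov Phi i z =
  \sum_(s < m) (sgn (odd m) * sgn (odd s) * sgn (odd s && odd (m.-1 - s)%N)) *:
    (Xp i (m.-1 - s) w \ov K s).
Proof.
rewrite Epsx_Phi // pi Tau_Xp_Tau // cmp_sumr cmp_suml scaler_sumr;
  apply: eq_bigr => s _.
rewrite cmpZr_sgn cmpZl scalerA -mulrA -scalerA -[RHS]scalerA; congr (_ *: _).
rewrite -scalerA; congr (_ *: _);
  rewrite !cmpA -wh_cmp -/(Epsx i s w) whEpsx_Xp pi !andbT.
by rewrite !cmpZl -!cmpA.
Qed.

(** The unit is t = -1. [Sig] kills [Phi] by the braid relation, with tau squared zero needed for n
    = 0; n + 1 dots leave minus the curl K n, and for n + 2 dots the two multiples of x_i cancel. *)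
Lemma slide_eq_pos : h i (E i :: w) = Posz n.+2 ->
  Bub i (E i :: w) = wh (E i) (Bub i w).
Proof.
move=> hE'; have ev : gr false (-1) by have := even_sgn gr true.
have un : (-1 : k) \is a GRing.unit by rewrite unitrN1.
have f0 r s : (s < n)%N -> Xp i r w \ov K s = 0.
  by move=> ls; rewrite curl_small ?cmp0r.
apply: (slide_of_Phi pi ev un hE hE') => [|m lm|].
- rewrite /Phi !cmpA -Sig_braid_diag -[LHS]cmpA -wh_cmp (Sig_Zeta hE).
  case: (n) => [|m]; last by rewrite wh0 cmp0r.
  by rewrite -cmpA Sig_Eta cmpA -wh_cmp TauK_diag wh0 cmp0l.
- rewrite -/z Epsx_Phi_diag; have [le|] := leqP m n.
    by rewrite (sign_sum_small f0 le) eqSS ltn_eqF.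
  move=> ln; have -> : m = n.+1 by apply/eqP; rewrite eqn_leq ln -ltnS lm.
  by rewrite (sign_sum1 f0) eqxx Xp0 cmp1l curl_top scaleN1r.
rewrite -/z Epsx_Phi_diag (sign_sum2 f0) Xp0 cmp1l curl_next curl_top Xp1 cmp1r.
by rewrite opprD addrCA subrr addr0 scaleN1r.
Qed.

End NonNegative.

Section NonPositive.
Variables (i : I) (n : nat) (w : wd).
Hypotheses (pi : par i) (hE : h i (E i :: w) = - Posz n).
Let g := Gama i n (E i :: w).
(** The dual of the curl [K]: the cup is now the generating one and the cap is [Gama]. *)
Let L m := g \ov wh (F i) (Tau i i w \ov Xp i m (E i :: w))
  \ov Eta i (E i :: w).

Lemma cocurl0 : L 0 = if n is 0%N then id (E i :: w) else 0.
Proof.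
rewrite /L Xp0 cmp1r -cmpA -Sig_Eta cmpA (Gama_Sig hE).
by case: (n) => [|m]; [apply: zigzagE | rewrite cmp0l].
Qed.

Lemma cocurlS m : L m.+1 = g \ov Etax i m (E i :: w) + sgn (odd n)
  *: (Xd i w \ov L m).
Proof.
have t : Tau i i w \ov Xd i (E i :: w) = id _ - wh (E i) (Xd i w) \ov Tau i i w.
  by rewrite -(TauDotl_diag w i) pi sgn1 scaleN1r opprK addrK.
rewrite /L XpS cmpA t cmpBl cmp1l whB cmpBr cmpBl -[X in X - _]cmpA;
  congr (_ + _).
rewrite -[X in wh _ X]cmpA wh_cmp cmpA (Gama_nat n pi (hhom_Dot i w)) pi /=.
by rewrite !cmpZl sgn_neg scaleNr opprK !cmpA.
Qed.

Lemma cocurl_small m : (m < n)%N -> L m = 0.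
Proof.
elim: m => [|m IH] lm; first by rewrite cocurl0; case: (n) lm.
by rewrite cocurlS (Gama_Etax hE (ltnW lm))
  ltn_eqF // add0r IH ?cmp0r ?scaler0 // ltnW.
Qed.

Lemma cocurl_top : L n = id (E i :: w).
Proof.
have [n0|] := posnP n; first by rewrite n0 cocurl0 n0.
case nE : n => [|m] // _; have lm : (m < n)%N by rewrite nE.
rewrite -nE [in LHS]nE cocurlS (Gama_Etax hE lm) nE eqxx.
by rewrite cocurl_small ?cmp0r ?scaler0 ?addr0.
Qed.

Lemma cocurl_next : L n.+1 = Bub i (E i :: w) + sgn (odd n) *: Xd i w.
Proof. by rewrite cocurlS cocurl_top cmp1r (Bub_Gama pi hE). Qed.

Lemma Psi_Etax_diag m : Psi g \ov wh (E i) (Etax i m w) =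
  \sum_(s < m) (sgn (odd m) * sgn (odd s) * sgn (odd s && odd (m.-1 - s)%N)) *:
    (L s \ov Xp i (m.-1 - s) w).
Proof.
rewrite Psi_Etax // pi Tau_whXp_Tau // wh_sum cmp_sumr cmp_suml scaler_sumr.
apply: eq_bigr => s _.
rewrite wh_sgn cmpZr_sgn cmpZl -!scalerA /=; do 2!congr (_ *: _).
rewrite -[X in wh _ X]cmpA.
have -> : wh (E i) (Xp i (m.-1 - s) w) \ov Xp i s (E i :: w) =
    sgn (odd s && odd (m.-1 - s)%N) *: (Xp i s (E i :: w)
      \ov wh (E i) (Xp i (m.-1 - s) w)).
  by rewrite (Xp_nat (hhom_Xp i (m.-1 - s) w))
    pi !andbT [odd s && _]andbC scalerA sgn_sq scale1r.
rewrite cmpZr_sgn wh_sgn cmpZr_sgn cmpZl; congr (_ *: _).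
by rewrite cmpA wh_cmp cmpA -[LHS]cmpA -Eta_nat cmpA.
Qed.

Lemma slide_eq_neg : h i w = - Posz n.+2 ->
  Bub i (E i :: w) = wh (E i) (Bub i w).
Proof.
move=> hE'; have ev : gr false (-1) by have := even_sgn gr true.
have un : (-1 : k) \is a GRing.unit by rewrite unitrN1.
have f0 r s : (s < n)%N -> L s \ov Xp i r w = 0.
  by move=> ls; rewrite cocurl_small ?cmp0l.
apply: (slide_of_Psi pi ev un hE' hE) => [|m lm|].
- rewrite /Psi -2!cmpA [X in _ \ov X]cmpA Sig_braid_diag !cmpA (Gama_Sig hE).
  case: (n) => [|m]; last by rewrite !cmp0l.
  by rewrite Eps_Sig -cmpA TauK_diag cmp0r.
- rewrite -/g Psi_Etax_diag; have [le|] := leqP m n.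
    by rewrite (sign_sum_small (f := fun r s =>
      L s \ov Xp i r w) f0 le) eqSS ltn_eqF.
  move=> ln; have -> : m = n.+1 by apply/eqP; rewrite eqn_leq ln -ltnS lm.
  rewrite (sign_sum1 (f := fun r s =>
    L s \ov Xp i r w) f0) eqxx Xp0 cmp1r cocurl_top.
  by rewrite scaleN1r.
rewrite -/g Psi_Etax_diag (sign_sum2 (f := fun r s => L s \ov Xp i r w) f0).
rewrite Xp0 cmp1r cocurl_next cocurl_top Xp1 cmp1l.
by rewrite opprD addrCA subrr addr0 scaleN1r.
Qed.

End NonPositive.

Section Crossing.
Variables (i : I) (w : wd).
Hypotheses (pi : par i) (hE : h i w = - Posz 1) (hE' : h i (E i :: w) = Posz 1).

Lemma slide_eq_cross : Bub i (E i :: w) = wh (E i) (Bub i w).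
Proof.
(* E sigma v is the difference of the two units of the adjunction, delta and
   E eta.  It is evaluated through tau v = 0, hence v = tau x v. *)
pose u := E i :: w; pose delta := Del i 0 u; pose gamma := Gam i 0 w.
have hn : hneg i (tgt l w) = 1%N by have [] := hnegP hE.
have hp' : hpos i (tgt l u) = 1%N by have [] := hposP hE'.
have SigSinv : Sig i i w \ov Sinv i i w = id _ - Eta i w \ov gamma.
  by rewrite -M_FE hn big_ord1 Etax0 addrK.
have SinvSig : Sinv i i w \ov Sig i i w = id _ by apply: (SinvK_neg hE).
have Meps : Sinv i i u \ov Sig i i u + delta \ov Eps i u = id _.
  by rewrite -M_EF hp' big_ord1 Epsx0.
have Sd : Sig i i u \ov delta = 0 by apply: Sig_Del; rewrite hp'.
have ed : Eps i u \ov delta = id u.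
  by have := Epsx_Del (w := u) (i := i) (m := 0) (n := 0); rewrite hp' Epsx0;
    apply.
have [v vdef] : exists v : hom u [:: E i, E i, F i & w],
    v = wh (E i) (Sinv i i w) \ov delta by exists (wh (E i) (Sinv i i w)
      \ov delta).
(* The braid relation with E_i sigma inverted on the right; the defect eta gamma becomes a double
   crossing by [Sig_Eta] and vanishes. *)
have tS : wh (F i) (Tau i i w) \ov Sig i i u
    = Sig i i u \ov wh (E i) (Sig i i w) \ov Tau i i (F i :: w)
      \ov wh (E i) (Sinv i i w).
  rewrite -Sig_braid_diag -[RHS]cmpA -wh_cmp SigSinv whB wh_id cmpBr cmp1r
    wh_cmp.
  rewrite [X in _ - X]cmpA -[X in _ - X
    \ov _]cmpA Sig_Eta cmpA -wh_cmp TauK_diag.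
  by rewrite wh0 !cmp0l subr0.
have STv : Sig i i u \ov (wh (E i) (Sig i i w) \ov Tau i i (F i :: w)
  \ov v) = 0.
  by rewrite vdef !cmpA -tS -cmpA Sd cmp0r.
have ETv : Eps i u \ov (wh (E i) (Sig i i w) \ov Tau i i (F i :: w) \ov v) = 0.
  by rewrite !cmpA Eps_Sig -[X in X \ov v]cmpA TauK_diag cmp0r cmp0l.
(* Both entries of M over [u] kill E_i sigma tau v, so it is zero; sigma over [w] cancels because it
   has a left inverse. *)
have Tv : Tau i i (F i :: w) \ov v = 0.
  have : wh (E i) (Sig i i w) \ov Tau i i (F i :: w) \ov v = 0.
    rewrite -[LHS]cmp1l -Meps cmpDl -[X in X + _]cmpA -[X in _ + X]cmpA.
    by rewrite STv ETv !cmp0r addr0.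
  move=> /(congr1 (cmp (wh (E i) (Sinv i i w)))).
  by rewrite cmp0r !cmpA -wh_cmp SinvSig wh_id cmp1l.
have deltaE : delta = wh (E i) (Sig i i w) \ov v
    + wh (E i) (Eta i w) \ov wh (E i) gamma \ov delta.
  rewrite vdef cmpA -!wh_cmp -cmpDl -whD SigSinv subrK wh_id.
  by rewrite cmp1l.
(* Capping the formula for [delta] off with eps turns one summand into a cap on tau v = 0 and
   straightens the zigzag in the other. *)
have gd : wh (E i) gamma \ov delta = id u.
  have := congr1 (cmp (Eps i u)) deltaE;
    rewrite ed cmpDr !cmpA Eps_Sig -[X in X + _]cmpA Tv.
  by rewrite cmp0r add0r zigzagE cmp1l.
have {}deltaE : delta = wh (E i) (Sig i i w) \ov v + wh (E i) (Eta i w).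
  by rewrite [LHS]deltaE -[X in _ + X]cmpA gd cmp1r.
have vE : Tau i i (F i :: w) \ov Xd i (E i :: F i :: w) \ov v = v.
  have := congr1 (fun X => X \ov v) (TauDotl_diag (F i :: w) i); cbv beta.
  by rewrite cmpBl cmpZl -[X in _ *: X]cmpA Tv cmp0r scaler0 subr0 cmp1l.
(* With one dot and a cap, the summand E_i eta of [delta] straightens to x_i, and the other reduces
   by v = tau x v. *)
have BubE : Bub i u = Xd i w - wh (E i) (Eps i w) \ov v.
  rewrite (Bub_pos hE') /Epsx Xp1 -/delta deltaE cmpDr addrC; congr (_ + _).
    by rewrite -cmpA (Dot_nat (hhom_Eta i w)) sgn0 scale1r cmpA zigzagE cmp1l.
  rewrite cmpA -[X in X \ov v = _]cmpA (Dot_nat (hhom_Sig i i w))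
    pi sgn1 scaleN1r.
  rewrite cmpNr cmpNl; congr (- _); rewrite cmpA Eps_Sig.
  by rewrite -[X in X \ov v]cmpA -[LHS]cmpA vE.
(* Slide x_i through [delta] and contract with gamma: gamma sigma = 0 and gamma eta = 1 leave the
   term in [v], while E_i eta produces the bubble. *)
have whBub : Xd i w = wh (E i) (Eps i w) \ov v + wh (E i) (Bub i w).
  have <- : wh (E i) gamma \ov (delta \ov Xd i w) = Xd i w.
    by rewrite cmpA gd cmp1l.
  rewrite (Del_nat (hhom_Dot i w)) andbF scale1r cmpA -/u -/delta deltaE cmpDr;
    congr (_ + _); last first.
    by rewrite -!wh_cmp (Bub_neg hE) /Etax Xp1 cmpA.
  rewrite cmpA -!wh_cmp -[gamma \ov _ \ov _]cmpA SigDot_diag cmpDr pi cmpZr_sgn !cmpA.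
  rewrite Gam_Sig ?hn // cmp0l scaler0 add0r; congr (wh _ _ \ov _).
  have := Gam_Etax (w := w) (i := i) (m := 0) (n := 0);
    rewrite hn Etax0 => -> //.
  by rewrite cmp1l.
by rewrite BubE {1}whBub addrAC subrr add0r.
Qed.
End Crossing.

(** * The slides past E_j and F_j *)

Lemma Bub_slideE i j w : par i -> Bub i (E j :: w) = wh (E j) (Bub i w).
Proof.
move=> pi; have hD : h i (E j :: w) = h i w - dij D i j by apply: hwtDalpha.
have [eij|nij] := eqVneq i j.
  rewrite -eij dij_diag opprK in hD *.
  (* The value h rises by 2; it changes sign only when it starts at -1. *)
  case hw : (h i w) => [n|[|n]].
  - by apply: (slide_eq_pos pi hw); rewrite hD hw; lia.
  - by apply: (slide_eq_cross pi); rewrite ?hD hw; lia.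
  - by apply: (slide_eq_neg (n := n) pi); rewrite ?hD hw; lia.
have dE : dij D i j = Posz (dn i j) by rewrite gez0_abs // dij_ge0.
(* The value h drops by d = [dn i j]. A start at h = 0 with d > 0 counts as nonpositive, so the
   sign-changing case has h > 0. *)
case hw : (h i w) => [n|n]; last first.
  by apply: (slide_neq_neg pi nij (n := n.+1) (n' := n.+1 + dn i j)) => //;
    rewrite ?hD hw ?dE; lia.
have [le|lt] := leqP (dn i j) n.
  by apply: (slide_neq_pos pi nij hw (n' := n - dn i j)); rewrite ?hD ?hw ?dE;
    lia.
case: n hw lt => [|n] hw lt.
  by apply: (slide_neq_neg pi nij (n := 0) (n' := dn i j)) => //;
    rewrite ?hD hw ?dE; lia.
by apply: (slide_neq_cross pi nij hw (n' := (dn i j - n.+2)%N));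
  rewrite ?hD ?hw ?dE; lia.
Qed.

(** Adjunction: naturality along the counit and the slide past E_j over [F j :: w] move the bubble
    through [Eps j w]; a zigzag then straightens F_j. *)
Lemma Bub_slideF i j w : par i -> Bub i (F j :: w) = wh (F j) (Bub i w).
Proof.
move=> pi.
have nat : Bub i w \ov Eps j w = Eps j w \ov wh (E j) (Bub i (F j :: w)).
  rewrite -Bub_slideE //.
  exact: (tl_natural_evenr (fun m => odd_bubble c i m) (hhom_Eps j w)).
rewrite -[RHS]cmp1r -zigzagF cmpA -wh_cmp nat wh_cmp -[RHS]cmpA -Eta_nat cmpA.
by rewrite zigzagF cmp1l.
Qed.

End Generators.

Theorem corollary7p4 (R : realType) (I : eqType) (D : super_cartan I)
    (H : realization R D) (k : unitRingType) (gr : supercommutative k)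
    (Q : parameters gr D) (c : normalization H Q) (i j : I) :
  par D i ->
  forall l : weight H,
    (odd_bubble c i (l + alpha H j) \oh id2 [:: E j]
       =[Q]= id2 [:: E j] \oh odd_bubble c i l)
    /\
    (odd_bubble c i (l - alpha H j) \oh id2 [:: F j]
       =[Q]= id2 [:: F j] \oh odd_bubble c i l).
Proof.
move=> pi l.
have wh_bubble s : cls Q (id2 [:: s] \oh odd_bubble c i l)
  = wh s (Bub l c i [::]).
  (* On the empty word the cast in [tl_nil] is along a loop. *)
  have -> : Bub l c i [::] = cls Q (odd_bubble c i l).
    by rewrite [LHS]tl_nil; apply: casth_loop.
  by rewrite /wh hmulE.
split; apply/(cls_eq Q); rewrite wh_bubble.
  by rewrite -Bub_slideE //; apply/esym/tlE.
by rewrite -Bub_slideF //; apply/esym/tlE.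
Qed.
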